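(* Let $D\subset\mathbb{C}$ be a hyperbolic planar domain that is not simply connected and let $p\in D$. Then the isotropy group $\mathrm{Iso}_p(D)$ is finite cyclic.
   Context: A hyperbolic planar domain is a domain (nonempty connected open set) in $\mathbb{C}$ whose universal covering Riemann surface is the open unit disk (equivalently, its Kobayashi pseudodistance is a distance). For $p\in D$, the isotropy group $\mathrm{Iso}_p(D)$ is the group, under composition, of all automorphisms of $D$ (biholomorphic maps of $D$ onto itself) that fix $p$. *)

(* Defs.v *)
From HB Require Import structures.
From mathcomp Require Import all_boot all_order all_algebra.
From mathcomp Require Import complex.
From mathcomp Require Import all_classical all_reals all_analysis.

Set Implicit Arguments.
Unset Strict Implicit.
Unset Printing Implicit Defensive.

Import Order.TTheory GRing.Theory Num.Theory.
Import numFieldNormedType.Exports.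

Local Open Scope classical_set_scope.
Local Open Scope ring_scope.

(* Seen as a [numClosedFieldType], the carrier inherits the topology and the
   structure of normed module over itself given by the modulus, so that
   [derivable f z 1] is complex differentiability of [f] at [z]. *)
Definition Cplx (R : realType) : numClosedFieldType := R[i].

Section PlanarDomains.
Variable R : realType.
Local Notation C := (Cplx R).
Implicit Types D E U V : set C.

Definition domain D := [/\ D !=set0, open D & connected D].

Definition unit_disk : set C := [set z | `|z| < 1].

Definition holomorphic_on (U : set C) (f : C -> C) :=
  forall z, U z -> derivable f z 1.

Definition unit_interval : set R := `[0, 1].
Definition unit_square : set (R * R) := unit_interval `*` unit_interval.

Definition path_in D (a b : C) (g : R -> C) :=
  [/\ {within unit_interval, continuous g},
      forall t, unit_interval t -> D (g t), g 0 = a & g 1 = b].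

Definition null_homotopic D (a : C) (g : R -> C) :=
  exists H : R * R -> C,
    [/\ {within unit_square, continuous H},
        forall st, unit_square st -> D (H st),
        forall t, unit_interval t -> H (0, t) = g t /\ H (1, t) = a &
        forall s, unit_interval s -> H (s, 0) = a /\ H (s, 1) = a].

Definition simply_connected D :=
  (forall a b, D a -> D b -> exists g, path_in D a b g) /\
  (forall a g, path_in D a a g -> null_homotopic D a g).

Definition homeomorphism_between V U (f : C -> C) :=
  [/\ set_bij V U f, {within V, continuous f} &
      exists2 g : C -> C, {within U, continuous g} &
        forall z, V z -> g (f z) = z].

Definition evenly_covered E (phi : C -> C) U :=
  exists F : set (set C),
    [/\ E `&` phi @^-1` U = \bigcup_(V in F) V, trivIset F id &
        forall V, F V -> open V /\ homeomorphism_between V U phi].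

(* [E] and [D] are meant to be open, so that the sheets are open in [E]. *)
Definition holomorphic_covering E D (phi : C -> C) :=
  [/\ holomorphic_on E phi, phi @` E = D &
      forall w, D w -> exists U,
        [/\ open U, U `<=` D, U w & evenly_covered E phi U]].

Definition universal_covering E D (phi : C -> C) :=
  simply_connected E /\ holomorphic_covering E D phi.

Definition hyperbolic_domain D :=
  domain D /\ exists phi : C -> C, universal_covering unit_disk D phi.

(* Maps [D -> D] are functions on the subtype, so they are determined by their
   values on [D]; differentiability at the points of the open set [D] does not
   depend on the extension [F]. *)
Definition holomorphic_self_map D (f : D -> D) :=
  exists2 F : C -> C, holomorphic_on D F &
    forall z : D, F (set_val z) = set_val (f z).

Record automorphism D := Automorphism {
  aut_fun :> D -> D;
  aut_inv : D -> D;
  aut_funK : cancel aut_fun aut_inv;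
  aut_invK : cancel aut_inv aut_fun;
  aut_fun_holo : holomorphic_self_map aut_fun;
  aut_inv_holo : holomorphic_self_map aut_inv
}.

End PlanarDomains.

Section AutomorphismGroup.
Variables (R : realType) (D : set (Cplx R)).
Implicit Types f g h : automorphism D.

Lemma holomorphic_self_map_id : @holomorphic_self_map R D id.
Proof. by exists id => // z _; exact: derivable_id. Qed.

Lemma holomorphic_self_map_comp (f g : D -> D) :
  holomorphic_self_map f -> holomorphic_self_map g ->
  holomorphic_self_map (f \o g).
Proof.
move=> [F hF eF] [G hG eG]; exists (F \o G) => [z Dz|z /=]; last by rewrite eG eF.
have DG : D (G z).
  rewrite -[z]/(set_val (exist (fun x => x \in D) z (mem_set Dz))) eG.
  exact: set_mem (valP (g _)).
apply/derivable1_diffP/differentiable_comp; apply/derivable1_diffP.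
- exact: hG.
- exact: hF.
Qed.

Lemma aut_eqP f g : f =1 g <-> f = g.
Proof.
split=> [fg|->//].
have fg' : aut_inv f =1 aut_inv g.
  by move=> z; rewrite -{1}(aut_invK g z) -fg aut_funK.
case: f g fg fg' => [f1 f2 ? ? ? ?] [g1 g2 ? ? ? ?] /= /funext e1 /funext e2.
by subst; congr Automorphism; exact: Prop_irrelevance.
Qed.

Definition aut_one : automorphism D :=
  Automorphism (fun=> erefl) (fun=> erefl)
    holomorphic_self_map_id holomorphic_self_map_id.

Definition aut_mul f g : automorphism D :=
  Automorphism (can_comp (aut_funK f) (aut_funK g))
    (can_comp (aut_invK g) (aut_invK f))
    (holomorphic_self_map_comp (aut_fun_holo f) (aut_fun_holo g))
    (holomorphic_self_map_comp (aut_inv_holo g) (aut_inv_holo f)).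

Definition aut_V f : automorphism D :=
  Automorphism (aut_invK f) (aut_funK f) (aut_inv_holo f) (aut_fun_holo f).

Lemma aut_mulA : associative aut_mul.
Proof. by move=> f g h; apply/aut_eqP. Qed.

Lemma aut_mul1 : left_id aut_one aut_mul.
Proof. by move=> f; apply/aut_eqP. Qed.

Lemma aut_mulr1 : right_id aut_one aut_mul.
Proof. by move=> f; apply/aut_eqP. Qed.

Lemma aut_mulV : left_inverse aut_one aut_V aut_mul.
Proof. by move=> f; apply/aut_eqP => z /=; rewrite aut_funK. Qed.

Lemma aut_mulrV : right_inverse aut_one aut_V aut_mul.
Proof. by move=> f; apply/aut_eqP => z /=; rewrite aut_invK. Qed.

HB.instance Definition _ := gen_eqMixin (automorphism D).
HB.instance Definition _ := gen_choiceMixin (automorphism D).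
HB.instance Definition _ := isGroup.Build (automorphism D)
  aut_mulA aut_mul1 aut_mulr1 aut_mulV aut_mulrV.

Variable p : D.

Definition fixes : {pred automorphism D} := fun f => `[< f p = p >].

Definition isotropy_group := {f : automorphism D | f \in fixes}.

Lemma fixes_group_closed : group_closed fixes.
Proof.
split=> [|f g]; first exact/asboolP.
move=> /asboolP fp /asboolP gp; apply/asboolP => /=.
by rewrite -{1}gp /= aut_funK.
Qed.

HB.instance Definition _ := Choice.on isotropy_group.
HB.instance Definition _ := SubType.on isotropy_group.
HB.instance Definition _ :=
  SubChoice_isSubGroup.Build (automorphism D) fixes isotropy_group
    fixes_group_closed.

End AutomorphismGroup.

Definition finite_group (G : groupType) := finite_set [set: G].

(* The library's [cyclic] is only about subgroups of a [finGroupType]. *)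
Definition cyclic_group (G : groupType) :=
  exists g : G, forall x : G, exists n : nat, x = (g ^+ n)%g \/ x = (g ^- n)%g.

(* Main.v *)
Require Import Defs.
From mathcomp Require Import all_boot all_order all_algebra.
From mathcomp Require Import cyclic complex.
From mathcomp Require Import all_classical all_reals all_analysis.
From mathcomp Require Import ring lra.

(** A hyperbolic domain that is not simply connected is covered by the unit disk with
    a nontrivial fibre, and its automorphisms fixing [p] lift to rotations permuting
    this fibre; that leaves only finitely many rotations.

    In detail, compose the universal covering with an automorphism of the disk so that
    the resulting covering [psi] sends 0 to [p] ([disk_covering_at]).  An automorphism
    [f] fixing [p] lifts to a holomorphic map [F] of the disk fixing 0 ([lift_exists],
    [lift_derivable]); the lift of the inverse of [f] is the inverse of [F], and the
    Schwarz lemma applied to both shows that [F] is a rotation [z |-> l * z]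
    ([rotation_exists]).  The number [l] is determined by [f], determines it, and is
    multiplicative in [f].  If 0 were the only point over [p], then [psi] would be
    injective ([trivial_fibre_injective]) and [D] would be homeomorphic to the disk
    ([injective_simply_connected]).  So some [a != 0] lies over [p], and all the [l * a]
    lie over [p] on the circle of radius [|a|], which meets the discrete fibre in a
    finite set ([finite_fibre]).  The isotropy group thus embeds into the multiplicative
    group of a field with finite image, so it is finite cyclic ([cyclic_of_range]).

    Two facts of complex analysis are needed for functions that are only assumed to be
    complex differentiable: the Schwarz lemma, and the nonvanishing of the derivative of
    an injective function, which makes lifts holomorphic.  Both are deduced from a
    maximum principle for functions continuous on a closed disk and differentiable
    inside except possibly at one point ([max_disk_except]).  The latter rests on
    Goursat's theorem for rectangles and on Cauchy's formula at the centre of a square,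
    in the weak form [|f z0| <= 4 M]: applied to all powers of [f], this gives
    [|f z0| <= M] ([max_square]), and a perturbation argument passes from squares to
    disks ([max_disk]). *)

Set Implicit Arguments.
Unset Strict Implicit.
Unset Printing Implicit Defensive.

Import Order.TTheory GRing.Theory Num.Theory.
Import numFieldNormedType.Exports.
Import Normc.

Local Open Scope classical_set_scope.
Local Open Scope ring_scope.

(** * The modulus as a real number *)

Section Modulus.
Variable R : realType.
Local Notation C := (Cplx R).
Implicit Types (z w : C) (f g : C -> C).

Definition cmod (z : C) : R := Normc.normc z.
Definition toC (x : R) : C := real_complex R x.

Lemma normE z : `|z| = toC (cmod z).
Proof. by case: z => x y; rewrite /cmod /=. Qed.

Lemma toC_lt x y : (toC x < toC y) = (x < y).
Proof. exact: ltcR. Qed.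
Lemma toC_le x y : (toC x <= toC y) = (x <= y).
Proof. exact: lecR. Qed.
Lemma cmodD z w : cmod (z + w) <= cmod z + cmod w. Proof. exact: le_normcD. Qed.
Lemma cmodM z w : cmod (z * w) = cmod z * cmod w. Proof. exact: normcM. Qed.
Lemma cmodN z : cmod (- z) = cmod z. Proof. exact: normcN. Qed.
Lemma cmodV z : cmod z^-1 = (cmod z)^-1. Proof. exact: normcV. Qed.
Lemma cmod0 : cmod 0 = 0. Proof. exact: normc0. Qed.
Lemma cmod1 : cmod 1 = 1. Proof. exact: normc1. Qed.
Lemma cmod_ge0 z : 0 <= cmod z. Proof. by rewrite -toC_le -normE normr_ge0. Qed.
Lemma cmod_eq0 z : (cmod z == 0) = (z == 0).
Proof. by apply/eqP/eqP => [/eq0_normc//|->]; rewrite cmod0. Qed.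
Lemma cmod_gt0 z : (0 < cmod z) = (z != 0).
Proof. by rewrite lt_neqAle cmod_ge0 andbT eq_sym cmod_eq0. Qed.
Lemma cmod_distC z w : cmod (z - w) = cmod (w - z).
Proof. by rewrite -cmodN opprB. Qed.
Lemma cmodX z n : cmod (z ^+ n) = cmod z ^+ n.
Proof. by elim: n => [|n IH]; rewrite ?cmod1// !exprS cmodM IH. Qed.
Lemma cmod_toC x : cmod (toC x) = `|x|.
Proof. by rewrite /cmod /= expr0n addr0 sqrtr_sqr. Qed.
Lemma cmod_leD z : cmod z <= `|complex.Re z| + `|complex.Im z|.
Proof.
case: z => x y; rewrite /cmod /= -[leRHS]ger0_norm ?addr_ge0// -sqrtr_sqr.
rewrite ler_wsqrtr// sqrrD !real_normK ?num_real//.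
by rewrite lerD2r lerDl mulrn_wge0// mulr_ge0.
Qed.

Lemma pos_toC (e : C) : 0 < e -> exists2 r : R, 0 < r & e = toC r.
Proof.
case: e => x y; rewrite ltcE /= => /andP[/eqP -> x0].
by exists x.
Qed.
Lemma toC_gt0 x : (0 < toC x) = (0 < x).
Proof. exact: (ltcR 0 x). Qed.

Lemma nbhsP z (P : set C) :
  nbhs z P <-> exists2 e : R, 0 < e & forall w, cmod (w - z) < e -> P w.
Proof.
split=> [/nbhs_ballP[e /= /pos_toC[r r0 ->]] H|[e e0 H]].
  by exists r => // w wz; apply: H; rewrite /ball/= normE toC_lt cmod_distC.
apply/nbhs_ballP; exists (toC e); rewrite /= ?toC_gt0// => w.
by rewrite /ball/= normE toC_lt cmod_distC => /H.
Qed.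

Lemma continuous_atP z f : {for z, continuous f} <-> forall e : R, 0 < e ->
  exists2 d : R, 0 < d & forall w, cmod (w - z) < d -> cmod (f w - f z) < e.
Proof.
split=> [H e e0|H]; last first.
  move=> P /nbhsP[e e0 eP]; have [d d0 dH] := H _ e0.
  by apply/nbhsP; exists d => // w /dH/eP.
have := H [set w | cmod (w - f z) < e]; case.
  by apply/nbhsP; exists e.
move=> d /= d0 dH; move/pos_toC: d0 => [r r0 dr]; exists r => // w wz.
by apply: dH; rewrite /= dr normE toC_lt cmod_distC.
Qed.

End Modulus.
Arguments cmod : simpl never.
Arguments toC : simpl never.

(** * Complex derivatives as continuous slopes *)

Section Calculus.
Variable R : realType.
Local Notation C := (Cplx R).
Implicit Types (z w d : C) (f g q : C -> C).

Lemma continuous_at_near z f g : (\forall w \near z, f w = g w) ->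
  {for z, continuous f} -> {for z, continuous g}.
Proof.
move=> fg; rewrite /prop_for => cf; rewrite /continuous_at -(nbhs_singleton fg).
move=> P /cf H; move: fg H; by apply: filterS2 => w /= -> .
Qed.

Lemma continuous_at_comp z f g : {for z, continuous g} -> {for g z, continuous f} ->
  {for z, continuous (fun w => f (g w))}.
Proof. by move=> cg cf P /cf /cg. Qed.

Lemma continuous_atD z f g : {for z, continuous f} -> {for z, continuous g} ->
  {for z, continuous (fun w => f w + g w)}.
Proof. by move=> cf cg; exact: (@cvgD C C C _ _ _ _ _ _ cf cg). Qed.

Lemma continuous_atN z f : {for z, continuous f} -> {for z, continuous (fun w => - f w)}.
Proof. by move=> cf; exact: (@cvgN C C C _ _ _ _ cf). Qed.

Lemma continuous_atB z f g : {for z, continuous f} -> {for z, continuous g} ->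
  {for z, continuous (fun w => f w - g w)}.
Proof. by move=> cf cg; exact: continuous_atD cf (continuous_atN cg). Qed.

Lemma continuous_atM z f g : {for z, continuous f} -> {for z, continuous g} ->
  {for z, continuous (fun w => f w * g w)}.
Proof. by move=> cf cg; exact: (@cvgM C C _ _ _ _ _ _ cf cg). Qed.

Lemma continuous_atV z f : f z != 0 -> {for z, continuous f} ->
  {for z, continuous (fun w => (f w)^-1)}.
Proof. by move=> f0 cf; exact: (@cvgV C C _ _ _ _ f0 cf). Qed.

Lemma continuous_at_cst z (c : C) : {for z, continuous ((fun=> c) : C -> C)}.
Proof. by move=> P Pc; apply/nbhsP; exists 1 => // w _; exact: nbhs_singleton Pc. Qed.

Lemma continuous_at_id z : {for z, continuous (fun w : C => w)}.
Proof. by move=> P. Qed.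

(** Caratheodory's form of the derivative: the slope [q] is a function continuous
    at [z], which makes products, compositions and inverses purely algebraic. *)
Definition has_derivative f z d :=
  exists q : C -> C, [/\ {for z, continuous q}, q z = d &
    forall w, f w - f z = q w * (w - z)].

(** Away from [z] the slope is forced to be the difference quotient, so only its
    values near [z] have to be supplied. *)
Lemma has_derivative_near f z d q : {for z, continuous q} -> q z = d ->
  (\forall w \near z, f w - f z = q w * (w - z)) -> has_derivative f z d.
Proof.
move=> cq qz fq.
exists (fun w => if w == z then d else (f w - f z) / (w - z)); split.
- apply: continuous_at_near cq; near=> w.
  case: eqP => [->|/eqP wz]; first exact: qz.
  by rewrite (near fq w)// mulfK// subr_eq0.
- by rewrite eqxx.
- move=> w; case: eqP => [->|/eqP wz]; first by rewrite !subrr mulr0.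
  by rewrite divfK// subr_eq0.
Unshelve. all: by end_near. Qed.

(** Bridge with the difference quotients of the library. *)
Lemma derivableP_slope f z : derivable f z 1 <-> exists d, has_derivative f z d.
Proof.
split.
- move=> /cvg_ex[/= l fl]; exists l.
  pose q w := if w == z then l else (f w - f z) / (w - z).
  exists q; split.
  + apply/continuous_atP => e e0; rewrite /q eqxx.
    have := fl [set w | cmod (w - l : C) < e]; case.
      by apply/nbhsP; exists e.
    move=> r /= r0 rH; case/pos_toC: r0 => r' r'0 rE; subst r.
    exists r' => // w wz; case: eqP => [_|/eqP wz0]; first by rewrite subrr cmod0.
    have := rH (w - z); rewrite /= sub0r normrN normE toC_lt => /(_ wz).
    rewrite subr_eq0 => /(_ wz0).
    by rewrite /shift/= [_ *: 1]mulr1 subrK /GRing.scale/= mulrC.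
  + by rewrite /q eqxx.
  + move=> w; rewrite /q; case: eqP => [->|/eqP wz]; first by rewrite !subrr mulr0.
    by rewrite divfK// subr_eq0.
- move=> [d [q [/continuous_atP cq qz fq]]].
  apply/cvg_ex; exists d => P /nbhsP[r r0 rP].
  have [s s0 sH] := cq _ r0.
  exists (toC s); rewrite /= ?toC_gt0// => h /=.
  rewrite sub0r normrN normE toC_lt => hs h0; apply: rP.
  have := sH (h + z); rewrite addrK => /(_ hs).
  rewrite /shift/= [_ *: 1]mulr1 fq addrK qz /GRing.scale/=.
  by rewrite mulrCA mulVf// mulr1.
Qed.

Lemma derivable_continuous_at f z : derivable f z 1 -> {for z, continuous f}.
Proof. by move=> /derivable1_diffP/differentiable_continuous. Qed.

Lemma derivable_comp1 f g z : derivable g z 1 -> derivable f (g z) 1 ->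
  derivable (fun w => f (g w)) z 1.
Proof.
move=> dg /derivableP_slope[e [p [cp _ fp]]]; have cg := derivable_continuous_at dg.
move/derivableP_slope : dg => [d [q [cq _ gq]]].
apply/derivableP_slope; exists (p (g z) * q z), (fun w => p (g w) * q w); split.
- exact: continuous_atM (continuous_at_comp cg cp) cq.
- by [].
- by move=> w; rewrite fp gq mulrA.
Qed.

Lemma derivable_near f g z : (\forall w \near z, f w = g w) ->
  derivable f z 1 -> derivable g z 1.
Proof.
move=> fg /derivableP_slope[d [q [cq qd fq]]]; apply/derivableP_slope; exists d.
apply: has_derivative_near cq qd _; near=> w.
by rewrite -(near fg w)// -(nbhs_singleton fg) fq.
Unshelve. all: by end_near. Qed.

Lemma derivable_slope f z : derivable f z 1 ->
  exists2 q : C -> C, {for z, continuous q} & forall w, f w - f z = q w * (w - z).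
Proof. by move=> /derivableP_slope[d [q [? ? ?]]]; exists q. Qed.

Definition seg (a b : C) (t : R) : C := a + toC t * (b - a).

Lemma seg0 a b : seg a b 0 = a. Proof. by rewrite /seg mul0r addr0. Qed.
Lemma seg1 a b : seg a b 1 = b.
Proof. by rewrite /seg mul1r addrC subrK. Qed.

Lemma toCB (s t : R) : toC (s - t) = toC s - toC t.
Proof. exact: rmorphB. Qed.
Lemma toCD (s t : R) : toC (s + t) = toC s + toC t.
Proof. exact: rmorphD. Qed.
Lemma toCM (s t : R) : toC (s * t) = toC s * toC t.
Proof. exact: rmorphM. Qed.

Lemma segB a b s t : seg a b s - seg a b t = toC (s - t) * (b - a).
Proof. by rewrite /seg toCB; ring. Qed.

Lemma seg_continuous a b t : {for t, continuous (seg a b)}.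
Proof.
move=> P /nbhsP[e e0 eP].
have c0 : 0 < cmod (b - a) + 1 by have := cmod_ge0 (b - a); lra.
apply/nbhs_ballP; exists (e / (cmod (b - a) + 1)) => /=; first exact: divr_gt0.
move=> s; rewrite /ball/= ltr_pdivlMr// => st; apply: eP.
rewrite segB cmodM cmod_toC distrC; apply: le_lt_trans st.
by apply: ler_wpM2l => //; lra.
Qed.

Lemma Re_continuous z : {for z, continuous (@complex.Re R : C -> R)}.
Proof.
move=> P /nbhs_ballP[e /= e0 eP]; apply/nbhsP; exists e => // w wz; apply: eP.
rewrite /ball/= distrC; apply: le_lt_trans wz.
have := normc_ge_Re (w - z); rewrite raddfB /=.
by rewrite normE toC_le.
Qed.

Lemma Im_le z : `|complex.Im z| <= cmod z.
Proof. by case: z => x y; rewrite /cmod/= -sqrtr_sqr ler_wsqrtr// lerDr sqr_ge0. Qed.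
Lemma Re_le z : `|complex.Re z| <= cmod z.
Proof. by case: z => x y; rewrite /cmod/= -sqrtr_sqr ler_wsqrtr// lerDl sqr_ge0. Qed.

Lemma Im_continuous z : {for z, continuous (@complex.Im R : C -> R)}.
Proof.
move=> P /nbhs_ballP[e /= e0 eP]; apply/nbhsP; exists e => // w wz; apply: eP.
by rewrite /ball/= distrC; apply: le_lt_trans wz; rewrite -raddfB; exact: Im_le.
Qed.

Lemma is_derive0 (u : R -> R) (t : R) :
  (forall e : R, 0 < e -> exists2 r : R, 0 < r &
     forall h, `|h| < r -> `|u (t + h) - u t| <= e * `|h|) ->
  is_derive t 1 u 0.
Proof.
move=> H.
have cv : (fun h : R => h^-1 *: (u (h *: (1 : R) + t) - u t)) @ 0^' --> (0 : R).
  apply/cvgrPdist_le => e /H[r r0 rH]; exists r => //= h.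
  rewrite /ball_ /= sub0r normrN => hr h0.
  rewrite sub0r normrN normrM normfV.
  rewrite ler_pdivrMl ?normr_gt0// [leRHS]mulrC [_ *: _]mulr1 (addrC h).
  exact: rH.
apply: DeriveDef; last exact: cvg_lim cv.
by apply/cvg_ex; exists 0.
Qed.

(** The mean value theorem fails for complex functions; it is applied to the real
    and imaginary parts of [f] along the segment.  Only
    continuity is asked at the end points, so that it applies to the quotient
    [F z / z] on a segment issued from the origin. *)
Lemma eq_of_derivative0 f a b :
  (forall t, 0 < t < 1 -> has_derivative f (seg a b t) 0) ->
  (forall t, 0 <= t <= 1 -> {for seg a b t, continuous f}) -> f a = f b.
Proof.
move=> f0 fc.
have key (p : C -> R) : {morph p : x y / x - y} -> (forall z, `|p z| <= cmod z) ->
    (forall z, {for z, continuous p}) -> p (f b) = p (f a).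
  move=> pB ple pc.
  have [|||t _] := @MVT R (p \o f \o seg a b) (fun=> 0) 0 1.
  - exact: ltr01.
  - move=> t; rewrite in_itv/= => t01; have [q [/continuous_atP qc q0 fq]] := f0 _ t01.
    have ba0 : 0 < cmod (b - a) + 1 by have := cmod_ge0 (b - a); lra.
    apply: is_derive0 => e e0.
    have [|r r0 rH] := qc (e / (cmod (b - a) + 1)); first exact: divr_gt0.
    exists (r / (cmod (b - a) + 1)); first exact: divr_gt0.
    move=> h; rewrite ltr_pdivlMr// => hr.
    have sE : seg a b (t + h) - seg a b t = toC h * (b - a).
      by rewrite segB addrAC subrr add0r.
    have sle : `|h| * cmod (b - a) <= `|h| * (cmod (b - a) + 1).
      by apply: ler_wpM2l => //; lra.
    rewrite /= -pB; apply: (le_trans (ple _)).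
    rewrite fq sE !cmodM cmod_toC.
    have /rH : cmod (seg a b (t + h) - seg a b t) < r.
      by rewrite sE cmodM cmod_toC (le_lt_trans sle).
    rewrite q0 subr0 => /ltW; rewrite ler_pdivlMr// => qe.
    rewrite mulrCA mulrC; apply: ler_wpM2r => //; apply: le_trans qe.
    by apply: ler_wpM2l; [exact: cmod_ge0|lra].
  - apply: continuous_in_subspaceT => t; rewrite inE/= in_itv/= => t01.
    apply: continuous_comp; first exact: seg_continuous.
    by apply: continuous_comp; [exact: fc|exact: pc].
  - by rewrite mul0r /= seg0 seg1 => /eqP; rewrite subr_eq0 => /eqP.
apply/eqP; rewrite eq_complex; apply/andP; split; apply/eqP/esym.
- apply: (key (@complex.Re R)); [exact: raddfB|exact: Re_le|exact: Re_continuous].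
- apply: (key (@complex.Im R)); [exact: raddfB|exact: Im_le|exact: Im_continuous].
Qed.

End Calculus.

(** * Integrals of complex functions of a real variable *)

Section Integral.
Variable R : realType.
Local Notation C := (Cplx R).
Local Notation mu := (@lebesgue_measure R).
Implicit Types (g h : R -> C).

(** Stated within the segment, on the two real components, because this is what
    integrability of continuous functions on a compact set consumes. *)
Definition path_cts (a b : R) g :=
  {within `[a, b], continuous (fun x => complex.Re (g x))} /\
  {within `[a, b], continuous (fun x => complex.Im (g x))}.

Definition cint (a b : R) g : C :=
  Complex (\int[mu]_(x in `[a, b]) complex.Re (g x))
          (\int[mu]_(x in `[a, b]) complex.Im (g x)).

Lemma within_integrable (a b : R) (u : R -> R) :
  {within `[a, b], continuous u} -> mu.-integrable `[a, b] (EFin \o u).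
Proof.
by move=> cu; apply: continuous_compact_integrable => //; exact: segment_compact.
Qed.

Lemma ReM (k z : C) : complex.Re (k * z) =
  complex.Re k * complex.Re z - complex.Im k * complex.Im z.
Proof. by case: k => k1 k2; case: z. Qed.
Lemma ImM (k z : C) : complex.Im (k * z) =
  complex.Re k * complex.Im z + complex.Im k * complex.Re z.
Proof. by case: k => k1 k2; case: z. Qed.

Lemma path_ctsZ a b (k : C) g : path_cts a b g -> path_cts a b (fun x => k * g x).
Proof.
move=> [g1 g2]; split => x.
- have -> : (fun x => complex.Re (k * g x)) = (fun x => complex.Re k * complex.Re (g x)
    - complex.Im k * complex.Im (g x)) by apply/funext => y; rewrite ReM.
  by apply: cvgB; (apply: cvgM; [exact: cvg_cst|]); [exact: g1|exact: g2].
- have -> : (fun x => complex.Im (k * g x)) = (fun x => complex.Re k * complex.Im (g x)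
    + complex.Im k * complex.Re (g x)) by apply/funext => y; rewrite ImM.
  by apply: cvgD; (apply: cvgM; [exact: cvg_cst|]); [exact: g2|exact: g1].
Qed.

Lemma path_ctsP a b g : (forall x, a <= x <= b -> {for x, continuous g}) -> path_cts a b g.
Proof.
move=> gc; split; apply: continuous_in_subspaceT => x; rewrite inE/= in_itv/= => xab;
  (apply: continuous_comp; first exact: gc).
- exact: Re_continuous.
- exact: Im_continuous.
Qed.

Lemma cint_eq a b g h : (forall x, a <= x <= b -> g x = h x) -> cint a b g = cint a b h.
Proof.
move=> gh; rewrite /cint; congr Complex; apply: eq_Rintegral => x;
 by rewrite inE/= in_itv/= => /gh ->.
Qed.

Lemma cintD a b g h : path_cts a b g -> path_cts a b h ->
  cint a b (fun x => g x + h x) = cint a b g + cint a b h.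
Proof.
move=> [g1 g2] [h1 h2]; rewrite /cint; apply/eqP; rewrite eq_complex/=; apply/andP; split; apply/eqP.
- under eq_Rintegral do rewrite raddfD/=.
  by rewrite RintegralD//; exact: within_integrable.
- under eq_Rintegral do rewrite raddfD/=.
  by rewrite RintegralD//; exact: within_integrable.
Qed.

Lemma integrableZ (a b k : R) (u : R -> R) : mu.-integrable `[a, b] (EFin \o u) ->
  mu.-integrable `[a, b] (EFin \o (fun x => k * u x)).
Proof.
move=> iu; have -> : EFin \o (fun x => k * u x) = (fun x => k%:E * (EFin \o u) x)%E.
  by apply/funext => x /=; rewrite EFinM.
exact: integrableZl.
Qed.

Lemma cintZ a b (k : C) g : path_cts a b g ->
  cint a b (fun x => k * g x) = k * cint a b g.
Proof.
move=> [/within_integrable g1 /within_integrable g2].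
apply/eqP; rewrite eq_complex ReM ImM /=; apply/andP; split; apply/eqP.
- under eq_Rintegral do rewrite ReM/=.
  rewrite RintegralB//; [|exact: integrableZ|exact: integrableZ].
  by rewrite !RintegralZl.
- under eq_Rintegral do rewrite ImM/=.
  rewrite RintegralD//; [|exact: integrableZ|exact: integrableZ].
  by rewrite !RintegralZl.
Qed.

Lemma Rint_cat (a b c : R) (u : R -> R) : a <= b -> b <= c ->
  mu.-integrable `[a, c] (EFin \o u) ->
  \int[mu]_(x in `[a, c]) u x = \int[mu]_(x in `[a, b]) u x + \int[mu]_(x in `[b, c]) u x.
Proof.
move=> ab bc iu; have := Rintegral_itvB iu.
move=> /(_ b); rewrite !bnd_simp => /(_ ab bc) /eqP; rewrite subr_eq => /eqP ->.
rewrite addrC; congr (_ + _); rewrite Rintegral_itv_obnd_cbnd//.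
apply: integrableS iu => //; apply: subset_itv; rewrite ?bnd_simp//.
Qed.

Lemma cint_cat a b c g : a <= b -> b <= c -> path_cts a c g ->
  cint a c g = cint a b g + cint b c g.
Proof.
move=> ab bc [g1 g2]; apply/eqP; rewrite eq_complex/=; apply/andP.
by split; apply/eqP; apply: Rint_cat => //; exact: within_integrable.
Qed.

Lemma Rint_cst (a b k : R) : a <= b -> \int[mu]_(x in `[a, b]) k = k * (b - a).
Proof.
move=> ab; rewrite Rintegral_cst//= lebesgue_measure_itv/= lte_fin.
by move: ab; rewrite le_eqVlt => /orP[/eqP ->|ab]; rewrite ?ltxx ?subrr// ab -EFinB.
Qed.

Lemma Rint_le (a b M : R) (u : R -> R) : a <= b -> {within `[a, b], continuous u} ->
  (forall x, a <= x <= b -> `|u x| <= M) ->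
  `|\int[mu]_(x in `[a, b]) u x| <= M * (b - a).
Proof.
move=> ab cu uM; have iu := within_integrable cu.
apply: le_trans (le_normr_Rintegral _ iu) _ => //.
rewrite -Rint_cst//; apply: le_Rintegral => //.
  by apply: integrable_norm.
by apply: within_integrable => x; exact: cvg_cst.
Qed.

(** The components are bounded separately, whence the factor 2; constants will
    be absorbed by [power_trick]. *)
Lemma cint_le a b M g : a <= b -> path_cts a b g ->
  (forall x, a <= x <= b -> cmod (g x) <= M) -> cmod (cint a b g) <= 2 * M * (b - a).
Proof.
move=> ab [g1 g2] gM.
apply: le_trans (cmod_leD _) _; rewrite /=.
have -> : 2 * M * (b - a) = M * (b - a) + M * (b - a) by ring.
apply: lerD; apply: Rint_le => // x xab; apply: le_trans (gM _ xab).
- exact: Re_le.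
- exact: Im_le.
Qed.

Lemma cint_cst a b (k : C) : a <= b -> cint a b (fun=> k) = k * toC (b - a).
Proof.
move=> ab; rewrite /cint !Rint_cst//; apply/eqP.
by rewrite eq_complex ReM ImM /= !mulr0 subr0 add0r !eqxx.
Qed.

Lemma path_cts_cst a b (k : C) : path_cts a b (fun=> k).
Proof. by apply: path_ctsP => x _; exact: cvg_cst. Qed.

End Integral.
Arguments cint : simpl never.

(** * Integrals along the boundary of a rectangle *)

Section Rectangle.
Variable R : realType.
Local Notation C := (Cplx R).
Implicit Types (f g : C -> C) (a b c d x y : R).

Definition pt x y : C := Complex x y.
Definition iC : C := Complex 0 1.

Lemma cmod_iC : cmod iC = 1.
Proof. by rewrite /cmod/= expr0n add0r expr1n sqrtr1. Qed.

Lemma ptx_continuous y x : {for x, continuous (fun t : R => pt t y)}.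
Proof.
move=> P /nbhsP[e e0 eP]; apply/nbhs_ballP; exists e => //= t.
rewrite /ball/= => xt; apply: eP; apply: le_lt_trans (cmod_leD _) _ => /=.
by rewrite subrr normr0 addr0 distrC.
Qed.

Lemma pty_continuous x y : {for y, continuous (fun t : R => pt x t)}.
Proof.
move=> P /nbhsP[e e0 eP]; apply/nbhs_ballP; exists e => //= t.
rewrite /ball/= => xt; apply: eP; apply: le_lt_trans (cmod_leD _) _ => /=.
by rewrite subrr normr0 add0r distrC.
Qed.

(** The contour integral of [f] along the boundary of the rectangle with opposite
    corners [a + ic] and [b + id], run counterclockwise. *)
Definition rect_int f a b c d : C :=
  cint a b (fun t => f (pt t c)) - cint a b (fun t => f (pt t d)) +
  iC * (cint c d (fun t => f (pt b t)) - cint c d (fun t => f (pt a t))).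

Definition edge_cts f a b c d :=
  [/\ path_cts a b (fun t => f (pt t c)), path_cts a b (fun t => f (pt t d)),
      path_cts c d (fun t => f (pt b t)) & path_cts c d (fun t => f (pt a t))].

Definition on_edges a b c d (P : C -> Prop) :=
  (forall t, a <= t <= b -> P (pt t c) /\ P (pt t d)) /\
  (forall t, c <= t <= d -> P (pt a t) /\ P (pt b t)).

Lemma edge_ctsP f a b c d :
  on_edges a b c d (fun z => {for z, continuous f}) -> edge_cts f a b c d.
Proof.
move=> [H V]; split; apply: path_ctsP => t tab P.
- by move=> /((H t tab).1); exact: ptx_continuous.
- by move=> /((H t tab).2); exact: ptx_continuous.
- by move=> /((V t tab).2); exact: pty_continuous.
- by move=> /((V t tab).1); exact: pty_continuous.
Qed.

Lemma rect_on_edges a b c d (P : C -> Prop) : a <= b -> c <= d ->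
  (forall x y, a <= x <= b -> c <= y <= d -> P (pt x y)) -> on_edges a b c d P.
Proof. by move=> ab cd H; split=> t tab; split; apply: H; rewrite ?lexx ?ab ?cd. Qed.

Lemma edge_ctsZ f a b c d (k : C) : edge_cts f a b c d ->
  edge_cts (fun z => k * f z) a b c d.
Proof. by move=> [? ? ? ?]; split; exact: path_ctsZ. Qed.

Lemma rect_intD f g a b c d : edge_cts f a b c d -> edge_cts g a b c d ->
  rect_int (fun z => f z + g z) a b c d = rect_int f a b c d + rect_int g a b c d.
Proof. by move=> [? ? ? ?] [? ? ? ?]; rewrite /rect_int !cintD//; ring. Qed.

Lemma rect_intZ f a b c d (k : C) : edge_cts f a b c d ->
  rect_int (fun z => k * f z) a b c d = k * rect_int f a b c d.
Proof. by move=> [? ? ? ?]; rewrite /rect_int !cintZ//; ring. Qed.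

Lemma rect_int_le f a b c d (M : R) : a <= b -> c <= d -> edge_cts f a b c d ->
  on_edges a b c d (fun z => cmod (f z) <= M) ->
  cmod (rect_int f a b c d) <= 4 * M * ((b - a) + (d - c)).
Proof.
move=> ab cd [f1 f2 f3 f4] [H V].
have h1 := cint_le ab f1 (fun x xab => (H x xab).1).
have h2 := cint_le ab f2 (fun x xab => (H x xab).2).
have h3 := cint_le cd f3 (fun x xab => (V x xab).2).
have h4 := cint_le cd f4 (fun x xab => (V x xab).1).
have cB (u v : C) : cmod (u - v) <= cmod u + cmod v.
  by rewrite -[cmod v]cmodN; exact: cmodD.
apply: le_trans (cmodD _ _) _; rewrite cmodM cmod_iC mul1r.
apply: le_trans (lerD (cB _ _) (cB _ _)) _.
lra.
Qed.

Lemma rect_int_eq f g a b c d : on_edges a b c d (fun z => f z = g z) ->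
  rect_int f a b c d = rect_int g a b c d.
Proof.
move=> [H V]; rewrite /rect_int; congr (_ - _ + _ * (_ - _)).
- by apply: cint_eq => x /H[].
- by apply: cint_eq => x /H[].
- by apply: cint_eq => x /V[].
- by apply: cint_eq => x /V[].
Qed.

Lemma rect_int_splitx f a m b c d : a <= m -> m <= b -> edge_cts f a b c d ->
  rect_int f a b c d = rect_int f a m c d + rect_int f m b c d.
Proof.
move=> am mb [f1 f2 _ _]; rewrite /rect_int.
rewrite (cint_cat am mb f1) (cint_cat am mb f2); ring.
Qed.

Lemma rect_int_splity f a b c m d : c <= m -> m <= d -> edge_cts f a b c d ->
  rect_int f a b c d = rect_int f a b c m + rect_int f a b m d.
Proof.
move=> cm md [_ _ f1 f2]; rewrite /rect_int.
rewrite (cint_cat cm md f1) (cint_cat cm md f2); ring.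
Qed.

Lemma ptE x y : pt x y = toC x + iC * toC y.
Proof.
apply/eqP; rewrite eq_complex /= !mul0r !mul1r; apply/andP; split; apply/eqP; ring.
Qed.

(** The integrals of the identity over opposite sides differ by the integral of a
    constant, so no primitive has to be computed. *)
Lemma rect_int_affine a b c d (k l : C) : a <= b -> c <= d ->
  rect_int (fun z => k + l * z) a b c d = 0.
Proof.
move=> ab cd.
have ecst (k' : C) : edge_cts (fun=> k') a b c d.
  by split; exact: path_cts_cst.
have eid : edge_cts (fun z => z) a b c d.
  by apply: edge_ctsP; apply: rect_on_edges => // x y _ _; exact: continuous_at_id.
rewrite rect_intD ?rect_intZ//; last exact: edge_ctsZ.
have [e1 e2 e3 e4] := eid.
have -> : rect_int (fun=> k) a b c d = 0 by rewrite /rect_int !subrr mulr0 addr0.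
suff -> : rect_int (fun z => z) a b c d = 0 by rewrite mulr0 addr0.
rewrite /rect_int.
have sub (s t : R) (u v : R -> C) (w : C) : s <= t -> path_cts s t u -> path_cts s t v ->
    (forall r, u r = v r + w) -> cint s t u - cint s t v = w * toC (t - s).
  move=> ab' cu cv uv; rewrite -(cint_cst _ ab').
  apply/eqP; rewrite subr_eq addrC -cintD//; last exact: path_cts_cst.
  by apply/eqP/cint_eq => r _.
rewrite (sub _ _ _ _ (iC * toC (c - d)) ab e1 e2); last first.
  by move=> t; rewrite !ptE toCB; ring.
rewrite (sub _ _ _ _ (toC (b - a)) cd e3 e4); last first.
  by move=> t; rewrite !ptE toCB; ring.
by rewrite !toCB; ring.
Qed.

End Rectangle.
Arguments rect_int : simpl never.
Arguments iC {R}.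

(** * Goursat theorem *)

Section Goursat.
Variable R : realType.
Local Notation C := (Cplx R).
Implicit Types (f g : C -> C) (a b c d x y : R).

(** Completeness in the form used by the bisection argument: [L n] is the length of
    the [n]-th interval. *)
Lemma nested_intervals (u L : nat -> R) :
  (forall n, u n <= u n.+1) -> (forall n, u n.+1 + L n.+1 <= u n + L n) ->
  (forall n, 0 <= L n) -> exists x, forall n, u n <= x <= u n + L n.
Proof.
move=> uS LS L0.
have umono : {homo u : m n / (m <= n)%N >-> m <= n} by exact/nondecreasing_seqP.
have vmono : {homo (fun n => u n + L n) : m n / (m <= n)%N >-> n <= m}.
  exact/nonincreasing_seqP.
have uv m n : u m <= u n + L n.
  apply: (@le_trans _ _ (u (maxn m n))); first exact/umono/leq_maxl.
  apply: (@le_trans _ _ (u (maxn m n) + L (maxn m n))); first by rewrite lerDl.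
  exact/vmono/leq_maxr.
have u0 : range u !=set0 by exists (u 0%N), 0%N.
have ub n : ubound (range u) (u n + L n) by move=> _ [m _ <-].
exists (sup (range u)) => n; apply/andP; split; last exact: sup_le_ub.
by apply: ub_le_sup; [exists (u 0%N + L 0%N)|exists n].
Qed.

Lemma quarter_of_sum (A B1 B2 B3 B4 : R) : A <= B1 + B2 + (B3 + B4) ->
  [\/ A <= 4 * B1, A <= 4 * B2, A <= 4 * B3 | A <= 4 * B4].
Proof.
move=> le4.
have [h1|h1] := leP A (4 * B1); first by constructor 1.
have [h2|h2] := leP A (4 * B2); first by constructor 2.
have [h3|h3] := leP A (4 * B3); first by constructor 3.
have [h4|h4] := leP A (4 * B4); first by constructor 4.
by exfalso; lra.
Qed.

(** Bisection step: the four quarters have integrals adding up to that of the whole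
    rectangle, so one of them carries at least a quarter of it. *)
Lemma rect_int_quarter f x y (l h : R) : 0 <= l -> 0 <= h ->
  (forall s t, x <= s <= x + 2 * l -> y <= t <= y + 2 * h ->
    {for pt s t, continuous f}) ->
  exists x' y', [/\ x <= x' & x' + l <= x + 2 * l] /\
    [/\ y <= y', y' + h <= y + 2 * h &
    cmod (rect_int f x (x + 2 * l) y (y + 2 * h)) <=
      4 * cmod (rect_int f x' (x' + l) y' (y' + h))].
Proof.
move=> l0 h0 fc.
have ec p q r s : x <= p -> p <= q -> q <= x + 2 * l -> y <= r -> r <= s ->
    s <= y + 2 * h -> edge_cts f p q r s.
  move=> xp pq ql yr rs sh; apply/edge_ctsP/rect_on_edges => // u v.
  by move=> /andP[pu uq] /andP[rv vs]; apply: fc; apply/andP; split; lra.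
pose r1 := rect_int f x (x + l) y (y + h).
pose r2 := rect_int f (x + l) (x + l + l) y (y + h).
pose r3 := rect_int f x (x + l) (y + h) (y + h + h).
pose r4 := rect_int f (x + l) (x + l + l) (y + h) (y + h + h).
have E : rect_int f x (x + 2 * l) y (y + 2 * h) = r1 + r2 + (r3 + r4).
  have -> : x + 2 * l = x + l + l by ring.
  have -> : y + 2 * h = y + h + h by ring.
  have lx : x <= x + l by lra.
  have lx2 : x + l <= x + l + l by lra.
  have ly : y <= y + h by lra.
  have ly2 : y + h <= y + h + h by lra.
  rewrite (rect_int_splity ly ly2 (ec _ _ _ _ _ _ _ _ _ _)); [|lra..].
  by rewrite (rect_int_splitx lx lx2 (ec _ _ _ _ _ _ _ _ _ _));
    [rewrite (rect_int_splitx lx lx2 (ec _ _ _ _ _ _ _ _ _ _)); [by []|lra..]|lra..].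
have lx : x <= x + l by lra.
have ly : y <= y + h by lra.
have lxx : x + l <= x + 2 * l by lra.
have lyy : y + h <= y + 2 * h by lra.
have lxx2 : x + l + l <= x + 2 * l by lra.
have lyy2 : y + h + h <= y + 2 * h by lra.
have le4 : cmod (rect_int f x (x + 2 * l) y (y + 2 * h)) <=
    cmod r1 + cmod r2 + (cmod r3 + cmod r4).
  by rewrite E; apply: le_trans (cmodD _ _) (lerD (cmodD _ _) (cmodD _ _)).
have [K|K|K|K] := quarter_of_sum le4.
- by exists x, y; split; split; rewrite ?lexx.
- by exists (x + l), y; split; split; rewrite ?lexx.
- by exists x, (y + h); split; split; rewrite ?lexx.
- by exists (x + l), (y + h); split; split.
Qed.

(** Quartering produces nested rectangles shrinking to a point [z], the integral over
    the [n]-th one being at least [4 ^- n] times the initial one.  At [z] the function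
    is affine up to an error [e * |w - z|], affine functions have zero integral, and
    both the perimeter and the diameter are of order [2 ^- n]: the initial integral is
    therefore at most a constant times [e]. *)
Lemma goursat f a b c d : a <= b -> c <= d ->
  (forall x y, a <= x <= b -> c <= y <= d -> derivable f (pt x y) 1) ->
  rect_int f a b c d = 0.
Proof.
move=> ab cd df.
have fc x y (xab : a <= x <= b) (ycd : c <= y <= d) : {for pt x y, continuous f}.
  exact/derivable_continuous_at/df.
pose L n : R := (b - a) / 2 ^+ n; pose H n : R := (d - c) / 2 ^+ n.
have LS n : L n = 2 * L n.+1.
  by rewrite /L exprS; field; rewrite expf_neq0.
have HS n : H n = 2 * H n.+1.
  by rewrite /H exprS; field; rewrite expf_neq0.
have L0 n : 0 <= L n by rewrite divr_ge0 ?subr_ge0// exprn_ge0.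
have H0 n : 0 <= H n by rewrite divr_ge0 ?subr_ge0// exprn_ge0.
pose N (n : nat) (p : R * R) := cmod (rect_int f p.1 (p.1 + L n) p.2 (p.2 + H n)).
pose inside (n : nat) (p : R * R) := [/\ a <= p.1, p.1 + L n <= b, c <= p.2 & p.2 + H n <= d].
pose good (n : nat) (p p' : R * R) :=
  [/\ p.1 <= p'.1, p'.1 + L n.+1 <= p.1 + L n,
      p.2 <= p'.2, p'.2 + H n.+1 <= p.2 + H n & N n p <= 4 * N n.+1 p'].
have /choice[next nextP] : forall np : nat * (R * R), exists p',
    inside np.1 np.2 -> good np.1 np.2 p'.
  move=> [n [x y]]; have [[/= ax xb cy yd]|ni] := pselect (inside n (x, y)); last by exists (x, y).
  have [|||x' [y' [[p1 p2] [q1 q2 q3]]]] := @rect_int_quarter f x y (L n.+1) (H n.+1) => //.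
    rewrite -LS -HS => s t /andP[s1 s2] /andP[t1 t2].
    by apply: fc; apply/andP; split; lra.
  by exists (x', y') => _; rewrite /good /N /= (LS n) (HS n).
pose fix s n := if n is m.+1 then next (m, s m) else (a, c).
have sin n : inside n (s n).
  elim: n => [|n IH]; first by split; rewrite /= /L /H ?expr0 ?divr1; lra.
  have [] := nextP (n, s n) IH; rewrite /= => g1 g2 g3 g4 _.
  by case: IH => i1 i2 i3 i4; split=> /=; lra.
have sgood n : good n (s n) (s n.+1) by apply: (nextP (n, s n)); exact: sin.
have sN n : N 0%N (s 0%N) <= 4 ^+ n * N n (s n).
  elim: n => [|n IH]; first by rewrite expr0 mul1r.
  apply: le_trans IH _; rewrite exprSr -mulrA ler_wpM2l ?exprn_ge0//.
  by case: (sgood n).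
have [x xP] : exists x, forall n, (s n).1 <= x <= (s n).1 + L n.
  by apply: (@nested_intervals (fun n => (s n).1)) => n; case: (sgood n).
have [y yP] : exists y, forall n, (s n).2 <= y <= (s n).2 + H n.
  by apply: (@nested_intervals (fun n => (s n).2)) => n; case: (sgood n).
have xab : a <= x <= b by have := xP 0%N; rewrite /= /L expr0 divr1; lra.
have ycd : c <= y <= d by have := yP 0%N; rewrite /= /H expr0 divr1; lra.
have [q /continuous_atP qc fq] := derivable_slope (df _ _ xab ycd).
set z := pt x y in q qc fq *.
pose aff w := (f z - q z * z) + q z * w.
pose T := (b - a) + (d - c).
have T0 : 0 <= T by rewrite /T; lra.
have N0E : N 0%N (s 0%N) = cmod (rect_int f a b c d).
  rewrite /N /= /L /H !expr0 !divr1.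
  have -> : a + (b - a) = b by ring.
 have -> : c + (d - c) = d by ring.
  by [].
apply/eqP; rewrite -cmod_eq0 eq_le cmod_ge0 andbT -N0E.
apply/ler_addgt0Pr => e e0; rewrite add0r.
pose e' := e / (4 * T ^+ 2 + 1).
have T20 : 0 < 4 * T ^+ 2 + 1 by have := sqr_ge0 T; lra.
have e'0 : 0 < e' by exact: divr_gt0.
have [r r0 rH] := qc _ e'0.
have [n nr] : exists n, T / 2 ^+ n < r.
  exists (Num.trunc (T / r)).+1; rewrite ltr_pdivrMr ?exprn_gt0// mulrC -ltr_pdivrMr//.
  apply: (@lt_trans _ _ (Num.trunc (T / r)).+1%:R); first exact: truncnS_gt.
  by rewrite -natrX ltr_nat ltn_expl.
have [i1 i2 i3 i4] := sin n; have /andP[x1 x2] := xP n; have /andP[y1 y2] := yP n.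
pose err w := f w - aff w.
have inr u v : (s n).1 <= u <= (s n).1 + L n -> (s n).2 <= v <= (s n).2 + H n ->
    a <= u <= b /\ c <= v <= d.
  by move=> /andP[u1 u2] /andP[v1 v2]; split; apply/andP; split; lra.
have l1 : (s n).1 <= (s n).1 + L n by rewrite lerDl.
have l2 : (s n).2 <= (s n).2 + H n by rewrite lerDl.
have ecaff : edge_cts aff (s n).1 ((s n).1 + L n) (s n).2 ((s n).2 + H n).
  apply/edge_ctsP/rect_on_edges => // u v _ _.
  by apply: continuous_atD; [exact: continuous_at_cst|apply: continuous_atM; [exact: continuous_at_cst|exact: continuous_at_id]].
have ecerr : edge_cts err (s n).1 ((s n).1 + L n) (s n).2 ((s n).2 + H n).
  apply/edge_ctsP/rect_on_edges => // u v uin vin.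
  have [uab vcd] := inr _ _ uin vin.
  apply: continuous_atB; first exact: fc.
  by apply: continuous_atD; [exact: continuous_at_cst|apply: continuous_atM; [exact: continuous_at_cst|exact: continuous_at_id]].
have Nn : N n (s n) <= 4 * (e' * (T / 2 ^+ n)) * (L n + H n).
  have -> : N n (s n) = cmod (rect_int err (s n).1 ((s n).1 + L n) (s n).2 ((s n).2 + H n)).
    rewrite /N (@rect_int_eq _ f (fun w => err w + aff w)); last first.
      by split=> t _; rewrite /err !subrK.
    by rewrite rect_intD// rect_int_affine// addr0.
  have -> : L n + H n = (s n).1 + L n - (s n).1 + ((s n).2 + H n - (s n).2) by ring.
  apply: rect_int_le => //; apply: rect_on_edges => // u v /andP[u1 u2] /andP[v1 v2].
  have dz : cmod (pt u v - z) <= T / 2 ^+ n.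
    apply: le_trans (cmod_leD _) _; rewrite /= /T mulrDl -/(L n) -/(H n).
    by apply: lerD; rewrite ler_norml; apply/andP; split; lra.
  have -> : err (pt u v) = (q (pt u v) - q z) * (pt u v - z).
    rewrite mulrBl -fq /err /aff; ring.
  rewrite cmodM; apply: ler_pM; rewrite ?cmod_ge0//.
  by apply/ltW/rH; exact: le_lt_trans nr.
apply: le_trans (sN n) _.
apply: le_trans (ler_wpM2l _ Nn) _; first by rewrite exprn_ge0.
have -> : 4 ^+ n * (4 * (e' * (T / 2 ^+ n)) * (L n + H n)) = e * (4 * T ^+ 2 / (4 * T ^+ 2 + 1)).
  have -> : (4 : R) ^+ n = 2 ^+ n * 2 ^+ n by rewrite -exprMn; congr (_ ^+ _); ring.
  rewrite /e' /L /H -mulrDl -/T; field.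
  by rewrite expf_neq0//= gt_eqF.
rewrite -[leRHS]mulr1; apply: ler_wpM2l; first exact: ltW.
by rewrite ler_pdivrMr// mul1r; lra.
Qed.

End Goursat.

(** * The Cauchy kernel on a square *)

Section CauchySquare.
Variable R : realType.
Local Notation C := (Cplx R).
Implicit Types (f g : C -> C) (a b c d x y : R).

Lemma holo_cst (c z : C) : derivable ((fun=> c) : C -> C) z 1.
Proof. exact: derivable_cst. Qed.
Lemma holo_id (z : C) : derivable (fun w : C => w) z 1.
Proof. exact: derivable_id. Qed.
Lemma holoD f g z : derivable f z 1 -> derivable g z 1 -> derivable (fun w => f w + g w) z 1.
Proof. by move=> df dg; exact: (derivableD df dg). Qed.
Lemma holoB f g z : derivable f z 1 -> derivable g z 1 -> derivable (fun w => f w - g w) z 1.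
Proof. by move=> df dg; exact: (derivableB df dg). Qed.
Lemma holoM f g z : derivable f z 1 -> derivable g z 1 -> derivable (fun w => f w * g w) z 1.
Proof. by move=> df dg; exact: (derivableM df dg). Qed.
Lemma holoV f z : f z != 0 -> derivable f z 1 -> derivable (fun w => (f w)^-1) z 1.
Proof. by move=> f0 df; exact: (derivableV f0 df). Qed.
Lemma holoX f z n : derivable f z 1 -> derivable (fun w => f w ^+ n) z 1.
Proof.
move=> df; elim: n => [|n IH]; first exact: holo_cst.
rewrite (_ : (fun _ => _) = (fun w => f w * f w ^+ n)); first exact: holoM.
by apply/funext => w; rewrite exprS.
Qed.

Lemma bernoulli (d : R) n : 0 <= d -> 1 + n%:R * d <= (1 + d) ^+ n.
Proof.
move=> d0; elim: n => [|n IH]; first by rewrite mul0r addr0.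
rewrite exprS; apply: le_trans (ler_wpM2l _ IH); last by rewrite addr_ge0.
rewrite -natr1; have : 0 <= n%:R * d * d by rewrite !mulr_ge0.
move: (n%:R : R) => N h.
have -> : (1 + d) * (1 + N * d) = 1 + (N + 1) * d + N * d * d by ring.
by rewrite lerDl.
Qed.

(** Landau's device for removing constants: a multiplicative bound with a constant
    [K] that holds for all powers holds with the constant 1. *)
Lemma power_trick (a b K : R) : 0 <= b -> (forall n, a ^+ n <= K * b ^+ n) -> a <= b.
Proof.
move=> b0 H; rewrite leNgt; apply/negP => ba.
have a0 : 0 < a by lra.
have [b00|b_gt0] := leP b 0.
  have := H 1%N; have -> : b = 0 by lra.
  by rewrite !expr1 mulr0; lra.
pose d := a / b - 1.
have d0 : 0 < d by rewrite /d subr_gt0 ltr_pdivlMr// mul1r.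
have B n : 1 + n%:R * d <= K.
  apply: le_trans (bernoulli n (ltW d0)) _.
  have -> : 1 + d = a / b by rewrite /d; ring.
  by rewrite expr_div_n ler_pdivrMr ?exprn_gt0.
have := B (Num.trunc (K / d)).+1; have := truncnS_gt (K / d).
by rewrite ltr_pdivrMr//; lra.
Qed.

Lemma path_cts_toC a b (u : R -> R) : {within `[a, b], continuous u} ->
  path_cts a b (fun t => toC (u t)).
Proof. by move=> cu; split=> //= t; exact: cvg_cst. Qed.

Lemma cint_toC a b (k : C) (u : R -> R) : {within `[a, b], continuous u} ->
  cint a b (fun t => k * toC (u t)) = k * toC (\int[@lebesgue_measure R]_(t in `[a, b]) u t).
Proof.
move=> cu; rewrite cintZ; last exact: path_cts_toC.
congr (_ * _); rewrite /cint/= /toC; congr Complex.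
by rewrite Rintegral_cst// mul0r.
Qed.

Lemma Rint_ge a b (M : R) (u : R -> R) : a <= b -> {within `[a, b], continuous u} ->
  (forall t, a <= t <= b -> M <= u t) ->
  M * (b - a) <= \int[@lebesgue_measure R]_(t in `[a, b]) u t.
Proof.
move=> ab cu H; rewrite -Rint_cst//; apply: le_Rintegral => //.
- by apply: within_integrable => x; exact: cvg_cst.
- exact: within_integrable.
Qed.

(** Up to a factor 1 or [i], the difference of the values of the Cauchy kernel at facing
    points of two opposite sides of a square of centre [x] and half side [s]. *)
Definition bump (x s t : R) : R := 2 * s / ((t - x) ^+ 2 + s ^+ 2).

Lemma bump_continuous (x s : R) (a b : R) : 0 < s ->
  {within `[a, b], continuous (bump x s)}.
Proof.
move=> s0; apply: continuous_subspaceT => t; rewrite /bump.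
have p0 : (t - x) ^+ 2 + s ^+ 2 != 0.
  by rewrite gt_eqF// ltr_wpDl ?sqr_ge0// exprn_gt0.
apply: cvgM; first exact: cvg_cst.
apply: cvgV => //; apply: cvgD; last exact: cvg_cst.
by apply: cvgM; (apply: cvgB; [exact: cvg_id|exact: cvg_cst]).
Qed.

Lemma bump_int (x s : R) : 0 < s ->
  2 <= \int[@lebesgue_measure R]_(t in `[x - s, x + s]) bump x s t.
Proof.
move=> s0; have <- : s^-1 * (x + s - (x - s)) = 2 by field; rewrite gt_eqF.
apply: Rint_ge; [by lra|exact: bump_continuous|move=> t /andP[t1 t2]].
have p0 : 0 < (t - x) ^+ 2 + s ^+ 2 by rewrite ltr_wpDl ?sqr_ge0// exprn_gt0.
rewrite /bump ler_pdivlMr// ler_pdivrMl//; nra.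
Qed.

Lemma on_edges_impl a b c d (P Q : C -> Prop) : (forall z, P z -> Q z) ->
  on_edges a b c d P -> on_edges a b c d Q.
Proof.
by move=> PQ [H V]; split=> t tab; [have [] := H t tab|have [] := V t tab]; split; exact: PQ.
Qed.

Section AtCentre.
Variables (x y s : R).
Hypothesis s0 : 0 < s.
Let z0 := pt x y.
Let ker (z : C) : C := (z - z0)^-1.

Lemma edge_dist : on_edges (x - s) (x + s) (y - s) (y + s) (fun z => s <= cmod (z - z0)).
Proof.
split=> t _; split.
- by apply: le_trans (Im_le _); rewrite /= addrAC subrr add0r normrN gtr0_norm.
- by apply: le_trans (Im_le _); rewrite /= addrAC subrr add0r gtr0_norm.
- by apply: le_trans (Re_le _); rewrite /= addrAC subrr add0r normrN gtr0_norm.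
- by apply: le_trans (Re_le _); rewrite /= addrAC subrr add0r gtr0_norm.
Qed.

Lemma edge_neq : on_edges (x - s) (x + s) (y - s) (y + s) (fun z => z != z0).
Proof.
apply: on_edges_impl edge_dist => z; apply: contraTneq => ->.
by rewrite subrr cmod0 -ltNge.
Qed.

Lemma ker_cts z : z != z0 -> {for z, continuous ker}.
Proof.
move=> zz0; apply: continuous_atV; first by rewrite subr_eq0.
by apply: continuous_atB; [exact: continuous_at_id|exact: continuous_at_cst].
Qed.

Lemma edge_cts_ker : edge_cts ker (x - s) (x + s) (y - s) (y + s).
Proof. by apply: edge_ctsP; apply: on_edges_impl edge_neq; exact: ker_cts. Qed.

Lemma ker_diff_h (t : R) : ker (pt t (y - s)) - ker (pt t (y + s)) =
  iC * toC (bump x s t).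
Proof.
have p0 : (t - x) ^+ 2 + s ^+ 2 != 0.
  by rewrite gt_eqF// ltr_wpDl ?sqr_ge0// exprn_gt0.
apply/eqP; rewrite eq_complex /bump /ker /z0 /pt /iC /toC /=; apply/andP; split; apply/eqP.
- have -> : y - s - y = - s by ring.
  have -> : y + s - y = s by ring.
  by rewrite sqrrN; ring.
- have -> : y - s - y = - s by ring.
  have -> : y + s - y = s by ring.
  by rewrite sqrrN; field.
Qed.

Lemma ker_diff_v (t : R) : ker (pt (x + s) t) - ker (pt (x - s) t) =
  1 * toC (bump y s t).
Proof.
have p0 : s ^+ 2 + (t - y) ^+ 2 != 0.
  by rewrite gt_eqF// ltr_wpDr ?sqr_ge0// exprn_gt0.
rewrite /bump mul1r (addrC (_ ^+ 2)).
apply/eqP; rewrite eq_complex /ker /z0 /pt /toC /=; apply/andP; split; apply/eqP.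
- have -> : x - s - x = - s by ring.
  have -> : x + s - x = s by ring.
  by rewrite sqrrN; field.
- have -> : x - s - x = - s by ring.
  have -> : x + s - x = s by ring.
  by rewrite sqrrN; ring.
Qed.

(** The exact value is [2 * pi * i]; bounding the integrals of [bump] from
    below avoids the evaluation of arctangents. *)
Lemma rect_int_ker : 4 <= cmod (rect_int ker (x - s) (x + s) (y - s) (y + s)).
Proof.
have [e1 e2 e3 e4] := edge_cts_ker.
have sub (p q : R) (u v : R -> C) (k : C) (r : R -> R) : path_cts p q u -> path_cts p q v ->
    {within `[p, q], continuous r} ->
    (forall t, u t - v t = k * toC (r t)) ->
    cint p q u - cint p q v = k * toC (\int[@lebesgue_measure R]_(t in `[p, q]) r t).
  move=> cu cv cr uv.
  have -> : cint p q u = cint p q (fun t => v t + k * toC (r t)).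
    by apply: cint_eq => t _; rewrite -uv addrC subrK.
  rewrite cintD//; last exact/path_ctsZ/path_cts_toC.
  by rewrite cint_toC// addrC addKr.
rewrite /rect_int (sub _ _ _ _ _ _ e1 e2 (@bump_continuous x s _ _ s0) ker_diff_h).
rewrite (sub _ _ _ _ _ _ e3 e4 (@bump_continuous y s _ _ s0) ker_diff_v).
rewrite mul1r -mulrDr -toCD cmodM cmod_iC mul1r cmod_toC.
have := bump_int x s0; have := bump_int y s0.
set A := Rintegral _ _ _; set B := Rintegral _ _ _ => A2 B2.
by apply: le_trans (ler_norm _); lra.
Qed.

End AtCentre.
End CauchySquare.

(** * The maximum principle on a square *)

Section CauchyInequality.
Variable R : realType.
Local Notation C := (Cplx R).
Implicit Types (f g : C -> C) (a b c d x y s : R).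

Lemma pt_inj (x y u v : R) : pt x y = pt u v -> x = u /\ y = v.
Proof. by case. Qed.

(** The region between two concentric squares is cut into four rectangles on each of
    which Goursat's theorem applies. *)
Lemma rect_int_shrink g x y s t : 0 < t -> t < s ->
  (forall u v, x - s <= u <= x + s -> y - s <= v <= y + s -> [\/ u < x, x < u, v < y | y < v] ->
     derivable g (pt u v) 1) ->
  rect_int g (x - s) (x + s) (y - s) (y + s) = rect_int g (x - t) (x + t) (y - t) (y + t).
Proof.
move=> t0 ts dg.
have gc u v : x - s <= u <= x + s -> y - s <= v <= y + s -> [\/ u < x, x < u, v < y | y < v] ->
    {for pt u v, continuous g} by move=> *; exact/derivable_continuous_at/dg.
have l1 : x - s <= x - t by lra.
have l2 : x - t <= x + t by lra.
have l3 : x + t <= x + s by lra.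
have l4 : x - t <= x + s by lra.
have m1 : y - s <= y - t by lra.
have m2 : y - t <= y + t by lra.
have m3 : y + t <= y + s by lra.
have m4 : y - t <= y + s by lra.
have m5 : y - s <= y + s by lra.
have zl : rect_int g (x - s) (x - t) (y - s) (y + s) = 0.
  apply: goursat => // u v /andP[u1 u2] /andP[v1 v2]; apply: dg; [by lra..|].
  by constructor 1; lra.
have zr : rect_int g (x + t) (x + s) (y - s) (y + s) = 0.
  apply: goursat => // u v /andP[u1 u2] /andP[v1 v2]; apply: dg; [by lra..|].
  by constructor 2; lra.
have zb : rect_int g (x - t) (x + t) (y - s) (y - t) = 0.
  apply: goursat => // u v /andP[u1 u2] /andP[v1 v2]; apply: dg; [by lra..|].
  by constructor 3; lra.
have zt : rect_int g (x - t) (x + t) (y + t) (y + s) = 0.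
  apply: goursat => // u v /andP[u1 u2] /andP[v1 v2]; apply: dg; [by lra..|].
  by constructor 4; lra.
have ec p q v w : x - s <= p < x -> x < q <= x + s -> y - s <= v < y -> y < w <= y + s ->
    edge_cts g p q v w.
  move=> /andP[p1 p2] /andP[q1 q2] /andP[v1 v2] /andP[w1 w2].
  apply/edge_ctsP; split=> r /andP[r1 r2]; split; apply: gc; try lra.
  - by constructor 3; lra.
  - by constructor 4; lra.
  - by constructor 1; lra.
  - by constructor 2; lra.
have E1 : edge_cts g (x - s) (x + s) (y - s) (y + s) by apply: ec; lra.
have E2 : edge_cts g (x - t) (x + s) (y - s) (y + s) by apply: ec; lra.
have E3 : edge_cts g (x - t) (x + t) (y - s) (y + s) by apply: ec; lra.
have E4 : edge_cts g (x - t) (x + t) (y - t) (y + s) by apply: ec; lra.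
rewrite (rect_int_splitx l1 l4 E1) zl add0r (rect_int_splitx l2 l3 E2) zr addr0.
by rewrite (rect_int_splity m1 m4 E3) zb add0r (rect_int_splity m2 m3 E4) zt addr0.
Qed.

(** The difference quotient at the centre is bounded, so its integral over the small
    squares given by [rect_int_shrink] tends to zero. *)
Lemma rect_int_slope f x y s : 0 < s ->
  (forall u v, x - s <= u <= x + s -> y - s <= v <= y + s -> derivable f (pt u v) 1) ->
  rect_int (fun z => (f z - f (pt x y)) * (z - pt x y)^-1) (x - s) (x + s) (y - s) (y + s) = 0.
Proof.
move=> s0 df; set z0 := pt x y; set g := (fun z : C => _).
have dg u v : x - s <= u <= x + s -> y - s <= v <= y + s -> [\/ u < x, x < u, v < y | y < v] ->
     derivable g (pt u v) 1.
  move=> us vs uv; apply: holoM.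
    by apply: holoB; [exact: df|exact: holo_cst].
  apply: holoV; last by apply: holoB; [exact: holo_id|exact: holo_cst].
  rewrite subr_eq0; apply/eqP => /pt_inj[ux vy].
  by case: uv => h; lra.
have dz0 : derivable f z0 1 by apply: df; lra.
have [q qc fq] := derivable_slope dz0.
move/continuous_atP : qc => /(_ 1 ltr01)[r r0 rH].
pose M := cmod (q z0) + 1.
have M0 : 0 < M by have := cmod_ge0 (q z0); rewrite /M; lra.
set I := rect_int _ _ _ _ _.
have small t : 0 < t -> t < s -> 2 * t < r -> cmod I <= 16 * M * t.
  move=> t0 ts tr; rewrite /I (rect_int_shrink t0 ts dg).
  have -> : 16 * M * t = 4 * M * (x + t - (x - t) + (y + t - (y - t))) by ring.
  have E : edge_cts g (x - t) (x + t) (y - t) (y + t).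
    apply/edge_ctsP; split=> v /andP[r1 r2]; split; apply/derivable_continuous_at/dg; try lra.
    - by constructor 3; lra.
    - by constructor 4; lra.
    - by constructor 1; lra.
    - by constructor 2; lra.
  apply: (rect_int_le _ _ E); [by lra|by lra|].
  have key u v : x - t <= u <= x + t -> y - t <= v <= y + t -> pt u v != z0 -> cmod (g (pt u v)) <= M.
    move=> /andP[u1 u2] /andP[v1 v2] uv; rewrite /g fq mulfK ?subr_eq0//.
    have : cmod (pt u v - z0) < r.
      apply: le_lt_trans (cmod_leD _) _; rewrite /=; apply: le_lt_trans tr.
      have -> : 2 * t = t + t by ring.
      by apply: lerD; rewrite ler_norml; apply/andP; split; lra.
    move=> /rH /ltW qr; rewrite -[q _](subrK (q z0)) /M addrC.
    apply: le_trans (cmodD _ _) _.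
    by rewrite lerD2l.
  have [H V] := edge_neq x y t0.
  split=> v /andP[v1 v2]; split; apply: key; try lra.
  - by have [] := H v; [exact/andP|].
  - by have [] := H v; [exact/andP|].
  - by have [] := V v; [exact/andP|].
  - by have [] := V v; [exact/andP|].
apply/eqP; rewrite -cmod_eq0 eq_le cmod_ge0 andbT leNgt; apply/negP => I0.
pose t := Num.min (Num.min (s / 2) (r / 4)) (cmod I / (32 * M)).
have t0 : 0 < t by rewrite !lt_min; apply/andP; split; [apply/andP; split; lra|apply: divr_gt0 => //; lra].
have t1 : t <= s / 2 by rewrite /t !ge_min lexx.
have t2 : t <= r / 4 by rewrite /t !ge_min lexx orbT.
have t3 : t <= cmod I / (32 * M) by rewrite /t !ge_min lexx orbT.
have := small t t0; move: t3; rewrite ler_pdivlMr; last by lra.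
move=> t3 /(_ _ _)/= H.
have : cmod I <= 16 * M * t by apply: H; lra.
lra.
Qed.

(** Cauchy's formula [f z0 * K = rect_int (f / (. - z0))], with [K] bounded below by
    [rect_int_ker].  The constant 4 is an artefact of crude bounds. *)
Lemma cauchy_rough f x y s (M : R) : 0 < s ->
  (forall u v, x - s <= u <= x + s -> y - s <= v <= y + s -> derivable f (pt u v) 1) ->
  on_edges (x - s) (x + s) (y - s) (y + s) (fun z => cmod (f z) <= M) ->
  cmod (f (pt x y)) <= 4 * M.
Proof.
move=> s0 df fM; set z0 := pt x y.
pose k (z : C) := (z - z0)^-1.
have ek : edge_cts k (x - s) (x + s) (y - s) (y + s) by exact: edge_cts_ker.
have ls : x - s <= x + s by lra.
have ms : y - s <= y + s by lra.
have neq : on_edges (x - s) (x + s) (y - s) (y + s) (fun z => z != z0) by exact: edge_neq.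
have cf : on_edges (x - s) (x + s) (y - s) (y + s) (fun z => {for z, continuous f}).
  by apply: (rect_on_edges ls ms) => u v us vs; exact/derivable_continuous_at/df.
have efk : edge_cts (fun z => f z * k z) (x - s) (x + s) (y - s) (y + s).
  apply: edge_ctsP; case: neq cf => [n1 n2] [c1 c2].
  split=> t tin; split; apply: continuous_atM.
  - by case: (c1 t tin).
  - by apply: ker_cts; case: (n1 t tin).
  - by case: (c1 t tin).
  - by apply: ker_cts; case: (n1 t tin).
  - by case: (c2 t tin).
  - by apply: ker_cts; case: (n2 t tin).
  - by case: (c2 t tin).
  - by apply: ker_cts; case: (n2 t tin).
have E : rect_int (fun z => f z * k z) (x - s) (x + s) (y - s) (y + s) =
    f z0 * rect_int k (x - s) (x + s) (y - s) (y + s).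
  have := rect_int_slope s0 df.
  rewrite (@rect_int_eq _ _ (fun z => f z * k z + (- f z0) * k z)); last first.
    by split=> t _; split; rewrite /k /z0; ring.
  rewrite rect_intD//; last exact: edge_ctsZ.
  by rewrite rect_intZ// mulNr => /eqP; rewrite subr_eq0 => /eqP.
have le1 : cmod (rect_int (fun z => f z * k z) (x - s) (x + s) (y - s) (y + s)) <= 16 * M.
  have -> : 16 * M = 4 * (M / s) * (x + s - (x - s) + (y + s - (y - s))).
    by field; rewrite gt_eqF.
  apply: (rect_int_le ls ms efk).
  have bd (z : C) : s <= cmod (z - z0) -> cmod (f z) <= M -> cmod (f z * k z) <= M / s.
    move=> zs fz; rewrite cmodM cmodV; apply: ler_pM; rewrite ?cmod_ge0 ?invr_ge0 ?cmod_ge0//.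
    by rewrite lef_pV2// posrE//; exact: lt_le_trans zs.
  case: fM (edge_dist x y s0) => [f1 f2] [d1 d2].
  split=> t tin; split; apply: bd.
  - by case: (d1 t tin).
  - by case: (f1 t tin).
  - by case: (d1 t tin).
  - by case: (f1 t tin).
  - by case: (d2 t tin).
  - by case: (f2 t tin).
  - by case: (d2 t tin).
  - by case: (f2 t tin).
have := rect_int_ker x y s0; rewrite -/k => K4.
move: le1; rewrite E cmodM => le1.
have : cmod (f z0) * 4 <= 16 * M.
  by apply: le_trans le1; apply: ler_wpM2l => //; exact: cmod_ge0.
lra.
Qed.

(** [cauchy_rough] applied to all powers of [f]. *)
Lemma max_square f x y s (M : R) : 0 < s ->
  (forall u v, x - s <= u <= x + s -> y - s <= v <= y + s -> derivable f (pt u v) 1) ->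
  on_edges (x - s) (x + s) (y - s) (y + s) (fun z => cmod (f z) <= M) ->
  cmod (f (pt x y)) <= M.
Proof.
move=> s0 df fM.
have M0 : 0 <= M.
  case: fM => [/(_ x) []]; first by lra.
  by move=> h _ _; apply: le_trans h; exact: cmod_ge0.
apply: (power_trick (K := 4)) => // n.
rewrite -cmodX; apply: (@cauchy_rough (fun z => f z ^+ n) x y s _ s0).
  by move=> u v us vs; apply/holoX/df.
apply: on_edges_impl fM => z fz; rewrite cmodX.
by apply: lerXn2r; rewrite ?nnegrE ?cmod_ge0.
Qed.

End CauchyInequality.

(** * The maximum principle on a disk *)

Section MaximumPrinciple.
Variable R : realType.
Local Notation C := (Cplx R).
Implicit Types (f g : C -> C) (a b z w : C) (K : set C).

Lemma pt_ReIm z : z = pt (complex.Re z) (complex.Im z). Proof. by case: z. Qed.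

Lemma cmod_dist z w : `|cmod z - cmod w| <= cmod (z - w).
Proof.
rewrite ler_norml; apply/andP; split.
  by have := cmodD (w - z) z; rewrite subrK (cmod_distC w z); lra.
by have := cmodD (z - w) w; rewrite subrK; lra.
Qed.

Lemma cmod_continuous z : {for z, continuous (@cmod R)}.
Proof.
move=> P /nbhs_ballP[e /= e0 eP]; apply/nbhsP; exists e => // w wz; apply: eP.
by rewrite /ball/= distrC; apply: le_lt_trans wz; exact: cmod_dist.
Qed.

Lemma continuous_at_cmod f z : {for z, continuous f} -> {for z, continuous (fun w => cmod (f w))}.
Proof. by move=> cf P /cmod_continuous /cf. Qed.

Lemma cmod_sqr z : cmod z ^+ 2 = complex.Re z ^+ 2 + complex.Im z ^+ 2.
Proof. by case: z => x y; rewrite /cmod/= sqr_sqrtr// addr_ge0 ?sqr_ge0. Qed.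

Lemma parallelogram z w :
  cmod (z + w) ^+ 2 + cmod (z - w) ^+ 2 = 2 * cmod z ^+ 2 + 2 * cmod w ^+ 2.
Proof. by rewrite !cmod_sqr; case: z => x y; case: w => u v /=; ring. Qed.

Definition cdisk a (r : R) : set C := [set z | cmod (z - a) <= r].

(** The function [u] is only continuous at the points of [K]; closedness of [K] takes
    care of the rest. *)
Lemma closed_superlevel K (u : C -> R) (m : R) : closed K ->
  (forall z, K z -> {for z, continuous u}) -> closed (K `&` [set z | m <= u z]).
Proof.
move=> cK cu; rewrite -openC openE => z /= Hz.
have [Kz|nKz] := pselect (K z).
- have uz : u z < m by rewrite ltNge; apply/negP => h; apply: Hz; split.
  have : nbhs z [set w | u w < m].
    have H : nbhs (u z) [set t : R | t < m].
      apply/nbhs_ballP; exists (m - u z); rewrite /= ?subr_gt0// => t.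
      by rewrite /ball/= ltr_distlC => /andP[_]; rewrite addrC subrK.
    exact: (cu z Kz _ H).
  move=> uw; apply/nbhsP; case/nbhsP: uw => e e0 uw; exists e => // w /uw /= wm [_ /=].
  by rewrite leNgt wm.
- have : open (~` K) by rewrite openC.
  rewrite openE => /(_ z nKz) /nbhsP[e e0 nK]; apply/nbhsP.
  by exists e => // w /nK /= nKw [/nKw].
Qed.

Lemma sub_continuous a z : {for z, continuous (fun w : C => cmod (w - a))}.
Proof. by apply: continuous_at_cmod; apply: continuous_atB; [exact: continuous_at_id|exact: continuous_at_cst]. Qed.

Lemma closed_cdisk a (r : R) : closed (cdisk a r).
Proof.
rewrite -openC openE => z /= /negP; rewrite -ltNge => rz.
apply/nbhsP; exists (cmod (z - a) - r); first by rewrite subr_gt0.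
move=> w wz; apply/negP; rewrite -ltNge.
have := cmod_dist (w - a) (z - a); rewrite opprB addrA subrK ler_norml => /andP[h _].
by move: wz h; lra.
Qed.

Lemma pt_continuous (p : R * R) : {for p, continuous (fun q : R * R => pt q.1 q.2)}.
Proof.
move=> P /nbhsP[e e0 eP].
have h0 : 0 < e / 2 by lra.
exists (ball p.1 (e / 2), ball p.2 (e / 2)).
  by split; apply: nbhsx_ballx.
move=> [u v] [/= bu bv]; apply: eP; apply: le_lt_trans (cmod_leD _) _ => /=.
have -> : e = e / 2 + e / 2 by field.
by apply: ltrD; rewrite distrC.
Qed.

Lemma compact_cdisk a (r : R) : compact (cdisk a r).
Proof.
pose I (c : R) : set R := [set` `[c - r, c + r]].
have cI : compact ((fun q : R * R => pt q.1 q.2) @` (I (complex.Re a) `*` I (complex.Im a))).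
  apply: continuous_compact.
    by apply: continuous_subspaceT => p; exact: pt_continuous.
  by apply: compact_setX; exact: segment_compact.
have -> : cdisk a r = (fun q : R * R => pt q.1 q.2) @` (I (complex.Re a) `*` I (complex.Im a)) `&` cdisk a r.
  apply/seteqP; split=> [z za|z []//]; split => //.
  have h1 := le_trans (Re_le (z - a)) za; have h2 := le_trans (Im_le (z - a)) za.
  move: h1 h2; rewrite !raddfB/= !ler_distl => /andP[? ?] /andP[? ?].
  exists (complex.Re z, complex.Im z); last exact/esym/pt_ReIm.
  by split; rewrite /I /= in_itv/=; apply/andP.
by apply: compact_closedI => //; exact: closed_cdisk.
Qed.

Lemma compact_max K (u : C -> R) : compact K -> K !=set0 ->
  (forall z, K z -> {for z, continuous u}) -> exists2 c, K c & forall z, K z -> u z <= u c.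
Proof.
move=> cK K0 cu; have [|c /set_mem Kc H] := @compact_EVT_max _ _ u K K0 cK.
  by apply: continuous_in_subspaceT => z /set_mem; exact: cu.
by exists c => // z Kz; apply: H; exact: mem_set.
Qed.

Lemma compact_min K (u : C -> R) : compact K -> K !=set0 ->
  (forall z, K z -> {for z, continuous u}) -> exists2 c, K c & forall z, K z -> u c <= u z.
Proof.
move=> cK K0 cu; have [|c /set_mem Kc H] := @compact_EVT_min _ _ u K K0 cK.
  by apply: continuous_in_subspaceT => z /set_mem; exact: cu.
by exists c => // z Kz; apply: H; exact: mem_set.
Qed.

Lemma cmodX_le z (m : R) n : cmod z <= m -> cmod z ^+ n <= m ^+ n.
Proof.
move=> zm; apply: lerXn2r => //; rewrite nnegrE ?cmod_ge0//.
by apply: le_trans zm; exact: cmod_ge0.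
Qed.

(** Let [Mx] be the maximum of [|f|], assumed larger than the bound on the circle, and
    let [z0] be a point where it is reached, chosen as far as possible from a point [o]
    outside the disk.  The factor [e w = (w - o) + (z0 - o)] satisfies, by the
    parallelogram identity, [|e w| < |e z0|] at every other maximum point [w].  Hence on
    a small square around [z0], for large [n], the modulus of [f ^ n * e] is larger at
    the centre than on the boundary: near the other maximum points thanks to [e],
    elsewhere thanks to [f ^ n].  This contradicts [max_square]. *)
Lemma max_disk f a (r M : R) : 0 < r ->
  (forall z, cmod (z - a) <= r -> {for z, continuous f}) ->
  (forall z, cmod (z - a) < r -> derivable f z 1) ->
  (forall z, cmod (z - a) = r -> cmod (f z) <= M) ->
  forall z, cmod (z - a) <= r -> cmod (f z) <= M.
Proof.
move=> r0 cf df fM z zr.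
set K := cdisk a r; have Kz : K z by [].
have cK : compact K by exact: compact_cdisk.
have clK : closed K by exact: closed_cdisk.
have cfK w : K w -> {for w, continuous (fun w => cmod (f w))}.
  by move=> Kw; exact/continuous_at_cmod/cf.
have [|c Kc cmax] := compact_max cK _ cfK; first by exists z.
apply: le_trans (cmax _ Kz) _; rewrite leNgt; apply/negP => Mc.
set Mx := cmod (f c) in cmax Mc.
have Mx0 : 0 < Mx.
  apply: le_lt_trans Mc; apply: le_trans (fM (a + toC r) _).
    exact: cmod_ge0.
  by rewrite addrAC subrr add0r cmod_toC gtr0_norm.
pose S := K `&` [set w | Mx <= cmod (f w)].
have clS : closed S by exact: closed_superlevel.
have cS : compact S.
  by apply: (subclosed_compact clS cK) => w [].
(* A point outside the disk, so that [e z0] does not vanish. *)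
pose o := a + toC (r + 1).
have S0 : S !=set0 by exists c; split => //=.
have [z0 [Kz0 /= z0M] z0max] := compact_max cS S0 (fun w _ => @sub_continuous o w).
have z0r : cmod (z0 - a) < r.
  rewrite lt_neqAle Kz0 andbT; apply/eqP => /fM.
  by rewrite leNgt => /negP; apply; exact: lt_le_trans z0M.
pose D := cmod (z0 - o).
have D0 : 0 < D.
  rewrite cmod_gt0 subr_eq0; apply: contraTneq z0r => ->.
  by rewrite /o addrAC subrr add0r cmod_toC gtr0_norm ?addr_gt0// -leNgt; lra.
pose e w := (w - o) + (z0 - o).
have eE w : cmod (e w) ^+ 2 = 2 * cmod (w - o) ^+ 2 + 2 * D ^+ 2 - cmod (w - z0) ^+ 2.
  have := parallelogram (w - o) (z0 - o); rewrite -/(e w) -/D.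
  have -> : w - o - (z0 - o) = w - z0 by ring.
  by move=> <-; rewrite addrK.
(* The square of half side [s] around [z0] lies in the open disk. *)
pose s := (r - cmod (z0 - a)) / 3.
have s0 : 0 < s by rewrite divr_gt0// subr_gt0.
have cte w : {for w, continuous (fun w => cmod (e w))}.
  apply: continuous_at_cmod; apply: continuous_atD; last exact: continuous_at_cst.
  by apply: continuous_atB; [exact: continuous_at_id|exact: continuous_at_cst].
pose E2 := 4 * D ^+ 2 - s ^+ 2 / 2.
(* [T] is away from every maximum point: there [f] stays below some [m < Mx]. *)
pose T := (K `&` [set w | s <= cmod (w - z0)]) `&` [set w | Num.sqrt E2 <= cmod (e w)].
have clT : closed T.
  by apply: closed_superlevel => [|w _]; [apply: closed_superlevel => // w _; exact: sub_continuous|exact: cte].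
have cT : compact T.
  by apply: (subclosed_compact clT cK) => w [[]].
have Tlt w : T w -> cmod (f w) < Mx.
  move=> [[Kw /= sw] ew]; rewrite ltNge; apply/negP => Mw.
  have Sw : S w by split.
  have := z0max _ Sw; rewrite -/D => wD.
  have h1 : cmod (w - o) ^+ 2 <= D ^+ 2 by rewrite lerXn2r// nnegrE cmod_ge0.
  have h2 : s ^+ 2 <= cmod (w - z0) ^+ 2 by rewrite lerXn2r// nnegrE ?cmod_ge0 ?ltW.
  have h3 : E2 <= cmod (e w) ^+ 2.
    have [E20|E20] := leP 0 E2; last by apply: le_trans (ltW E20) _; exact: sqr_ge0.
    by rewrite -(sqr_sqrtr E20) lerXn2r// nnegrE ?sqrtr_ge0// cmod_ge0.
  have s2 : 0 < s ^+ 2 by rewrite exprn_gt0.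
  by move: h3; rewrite eE /E2; lra.
have [m m0 [mM Tm]] : exists2 m, 0 <= m & m < Mx /\ forall w, T w -> cmod (f w) <= m.
  have [T0|/set0P/negP/negbNE/eqP T0] := pselect (T !=set0).
    have [w [[Kw sw] ew] wmax] := compact_max cT T0 (fun w (Tw : T w) => cfK w Tw.1.1).
    by exists (cmod (f w)); [exact: cmod_ge0|split => //; apply: Tlt; split].
  by exists 0 => //; split => // w; rewrite T0.
pose B := 2 * r + 1 + D.
have B0 : 0 < B by rewrite /B; lra.
have eB w : K w -> cmod (e w) <= B.
  move=> Kw; apply: le_trans (cmodD _ _) _; rewrite -/D /B lerD2r.
  have -> : w - o = (w - a) - toC (r + 1) by rewrite /o; ring.
  apply: le_trans (cmodD _ _) _; rewrite cmodN cmod_toC gtr0_norm ?addr_gt0//.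
  by have : cmod (w - a) <= r by []; lra.
have eD : Num.sqrt E2 < 2 * D.
  have -> : 2 * D = Num.sqrt (4 * D ^+ 2).
    have -> : 4 * D ^+ 2 = (2 * D) ^+ 2 by ring.
    by rewrite sqrtr_sqr gtr0_norm// mulr_gt0.
  rewrite ltr_sqrt; last by rewrite mulr_gt0// exprn_gt0.
  have s2 : 0 < s ^+ 2 by rewrite exprn_gt0.
  by rewrite /E2; lra.
have [n nB] : exists n, m ^+ n * B < Mx ^+ n * (2 * D).
  apply: contrapT => /forallNP H.
  suff : Mx <= m by rewrite leNgt mM.
  apply: (power_trick (K := B / (2 * D))) => // n.
  have /negP := H n; rewrite -leNgt => h.
  rewrite mulrAC ler_pdivlMr ?mulr_gt0//.
  by rewrite (mulrC B).
set x := complex.Re z0; set y := complex.Im z0.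
have ls : x - s <= x + s by lra.
have ms : y - s <= y + s by lra.
have inK u v : x - s <= u <= x + s -> y - s <= v <= y + s -> cmod (pt u v - a) < r.
  move=> /andP[u1 u2] /andP[v1 v2].
  have -> : pt u v - a = (pt u v - z0) + (z0 - a) by ring.
  apply: le_lt_trans (cmodD _ _) _.
  have : cmod (pt u v - z0) <= 2 * s.
    apply: le_trans (cmod_leD _) _; rewrite !raddfB /= -/x -/y.
    have -> : 2 * s = s + s by ring.
    by apply: lerD; rewrite ler_norml; apply/andP; split; lra.
  have : r = 3 * s + cmod (z0 - a) by rewrite /s; field.
  lra.
pose h w := f w ^+ n * e w.
have := @max_square _ h x y s (Num.max (m ^+ n * B) (Mx ^+ n * Num.sqrt E2)) s0.
rewrite -pt_ReIm => H.
have : cmod (h z0) <= Num.max (m ^+ n * B) (Mx ^+ n * Num.sqrt E2).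
  apply: H.
    move=> u v us vs; apply: holoM; first by apply/holoX/df/inK.
    by apply: holoD; [apply: holoB; [exact: holo_id|exact: holo_cst]|exact: holo_cst].
  have key w : s <= cmod (w - z0) -> cmod (w - a) < r ->
      cmod (h w) <= Num.max (m ^+ n * B) (Mx ^+ n * Num.sqrt E2).
    move=> sw wr; rewrite le_max /h cmodM cmodX.
    have Kw : K w by exact: ltW.
    have [ew|ew] := leP (Num.sqrt E2) (cmod (e w)).
      have Tw : T w by [].
      apply/orP; left; apply: ler_pM; rewrite ?exprn_ge0 ?cmod_ge0//; last exact: eB.
      by apply: cmodX_le; exact: Tm.
    apply/orP; right; apply: ler_pM; rewrite ?exprn_ge0 ?cmod_ge0//; last exact: ltW.
    by apply: cmodX_le; exact: cmax.
  have [e1 e2] := edge_dist x y s0.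
  rewrite /= -pt_ReIm in e1 e2.
  split=> t tin; split; apply: key.
  - by case: (e1 t tin).
  - by apply: inK => //; lra.
  - by case: (e1 t tin).
  - by apply: inK => //; lra.
  - by case: (e2 t tin).
  - by apply: inK => //; lra.
  - by case: (e2 t tin).
  - by apply: inK => //; lra.
have hz0 : cmod (h z0) = cmod (f z0) ^+ n * (2 * D).
  have e0 : e z0 = toC 2 * (z0 - o).
    rewrite /e; have -> : toC 2 = 1 + 1 :> C by rewrite -[2]/(1 + 1) toCD.
    ring.
  by rewrite /h cmodM cmodX e0 cmodM cmod_toC normr_nat.
apply/negP; rewrite -ltNge gt_max hz0.
have le1 : Mx ^+ n * (2 * D) <= cmod (f z0) ^+ n * (2 * D).
  apply: ler_wpM2r; first by rewrite mulr_ge0// ltW.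
  by rewrite lerXn2r// ?nnegrE ?cmod_ge0 ?ltW.
rewrite !(lt_le_trans _ le1)//.
by rewrite ltr_pM2l// exprn_gt0.
Qed.

(** A function continuous at [b] becomes differentiable there after multiplication by
    [w - b].  So [max_disk] applies to [f ^ n * (w - b)], and the factor [w - b]
    disappears by the power trick. *)
Lemma max_disk_except f a b (r M : R) : 0 < r ->
  (forall z, cmod (z - a) <= r -> {for z, continuous f}) ->
  (forall z, cmod (z - a) < r -> z != b -> derivable f z 1) ->
  (forall z, cmod (z - a) = r -> cmod (f z) <= M) ->
  forall z, cmod (z - a) <= r -> cmod (f z) <= M.
Proof.
move=> r0 cf df fM.
have M0 : 0 <= M.
  apply: le_trans (fM (a + toC r) _); first exact: cmod_ge0.
  by rewrite addrAC subrr add0r cmod_toC gtr0_norm.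
have ctX w n : {for w, continuous f} -> {for w, continuous (fun z => f z ^+ n)}.
  move=> cw; elim: n => [|n IH]; first exact: continuous_at_cst.
  rewrite (_ : (fun _ => _) = (fun z => f z * f z ^+ n)); first exact: continuous_atM.
  by apply/funext => z; rewrite exprS.
have main z : z != b -> cmod (z - a) <= r -> cmod (f z) <= M.
  move=> zb zr; have zb0 : 0 < cmod (z - b) by rewrite cmod_gt0 subr_eq0.
  pose B := r + cmod (a - b).
  apply: (power_trick (K := B / cmod (z - b))) => // n.
  rewrite mulrAC ler_pdivlMr// -cmodX -cmodM (mulrC B).
  apply: (@max_disk (fun w => f w ^+ n * (w - b)) a r _ r0 _ _ _ _ zr).
  - move=> w wr; apply: continuous_atM; first exact/ctX/cf.
    by apply: continuous_atB; [exact: continuous_at_id|exact: continuous_at_cst].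
  - move=> w wr; have [wb|wb] := eqVneq w b; last first.
      by apply: holoM; [exact/holoX/df|apply: holoB; [exact: holo_id|exact: holo_cst]].
    rewrite wb in wr *; apply/derivableP_slope; exists (f b ^+ n), (fun w => f w ^+ n); split.
    + exact/ctX/cf/ltW.
    + by [].
    + by move=> u; rewrite subrr mulr0 subr0.
  - move=> w wr; rewrite cmodM cmodX; apply: ler_pM; rewrite ?exprn_ge0 ?cmod_ge0//.
      by apply: cmodX_le; exact: fM.
    have -> : w - b = (w - a) + (a - b) by ring.
    by apply: le_trans (cmodD _ _) _; rewrite wr.
move=> z zr; have [zb|] := eqVneq z b; last by move/main; apply.
have [zr'|rz] := ltP (cmod (z - a)) r; last first.
  by apply: fM; apply/le_anti; rewrite zr.
rewrite leNgt; apply/negP => Mz.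
have /continuous_atP cz := cf _ zr.
have [|d d0 dH] := cz (cmod (f z) - M); first by rewrite subr_gt0.
pose t := Num.min (d / 2) (r - cmod (z - a)).
have t0 : 0 < t by rewrite lt_min; apply/andP; split; lra.
have t1 : t <= d / 2 by rewrite ge_min lexx.
have t2 : t <= r - cmod (z - a) by rewrite ge_min lexx orbT.
have ct : cmod (z + toC t - z) = t by rewrite addrAC subrr add0r cmod_toC gtr0_norm.
have h1 : cmod (f (z + toC t)) <= M.
  apply: main; first by rewrite -zb -subr_eq0 -cmod_gt0 ct.
  have -> : z + toC t - a = (z + toC t - z) + (z - a) by ring.
  by apply: le_trans (cmodD _ _) _; rewrite ct; lra.
have : cmod (f (z + toC t) - f z) < cmod (f z) - M by apply: dH; rewrite ct; lra.
have := cmod_dist (f (z + toC t)) (f z); rewrite ler_norml => /andP[h2 _].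
lra.
Qed.

End MaximumPrinciple.

(** * Injective functions and the Schwarz lemma *)

Section SchwarzLemma.
Variable R : realType.
Local Notation C := (Cplx R).
Implicit Types (f g q F : C -> C) (a b z w d : C).

Lemma near_neq z b : z != b -> \forall w \near z, w != b.
Proof.
move=> zb; apply/nbhsP; exists (cmod (z - b)); first by rewrite cmod_gt0 subr_eq0.
by move=> w; apply: contraTneq => ->; rewrite cmod_distC ltxx.
Qed.

Lemma slope_near f q b z : (forall w, f w - f b = q w * (w - b)) -> z != b ->
  \forall w \near z, (f w - f b) * (w - b)^-1 = q w.
Proof.
move=> fq zb; have /nbhsP[e e0 H] := near_neq zb.
by apply/nbhsP; exists e => // w /H wb; rewrite fq mulfK// subr_eq0.
Qed.

Lemma slope_derivable f q b z : (forall w, f w - f b = q w * (w - b)) -> z != b ->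
  derivable f z 1 -> derivable q z 1.
Proof.
move=> fq zb df; apply: derivable_near (slope_near fq zb) _; apply: holoM.
  by apply: holoB; [exact: df|exact: holo_cst].
by apply: holoV; [rewrite subr_eq0|apply: holoB; [exact: holo_id|exact: holo_cst]].
Qed.

Lemma cmod_sub_toC z (t : R) : 0 <= t -> cmod (z + toC t - z) = t.
Proof. by move=> t0; rewrite addrAC subrr add0r cmod_toC ger0_norm. Qed.

Lemma compact_circle a (r : R) : compact [set z : C | cmod (z - a) = r].
Proof.
have cl : closed (cdisk a r `&` [set z | r <= cmod (z - a)]).
  by apply: closed_superlevel => [|z _]; [exact: closed_cdisk|exact: sub_continuous].
have -> : [set z : C | cmod (z - a) = r] = cdisk a r `&` [set z | r <= cmod (z - a)].
  apply/seteqP; split=> z /=; rewrite /cdisk /=; first by move=> ->.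
  by move=> [h1 h2]; apply/le_anti; rewrite h1.
by apply: subclosed_compact cl (@compact_cdisk _ a r) _ => z [].
Qed.

(** Suppose the derivative vanishes at [z0].  For [z2] near [z0], the slope function
    [q2] of [f] at [z2] has no zero except possibly [z2] itself, by injectivity, and is
    bounded below by some [k] on a fixed circle around [z0].  If the derivative at [z2]
    were nonzero, the maximum principle for [1 / q2] would give [|q2 z0| >= k], that is
    [|f z2 - f z0| >= k |z2 - z0|], which fails for [z2] close to [z0].  So the
    derivative vanishes near [z0] and [f] is locally constant. *)
Lemma injective_derivative_neq0 f z0 d (rho : R) : 0 < rho ->
  (forall z, cmod (z - z0) < rho -> derivable f z 1) ->
  (forall z w, cmod (z - z0) < rho -> cmod (w - z0) < rho -> f z = f w -> z = w) ->
  has_derivative f z0 d -> d != 0.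
Proof.
move=> rho0 df finj [q [/continuous_atP qc qd fq]]; apply/eqP => d0.
pose r := rho / 2; have r0 : 0 < r by rewrite divr_gt0.
have rr : r < rho by rewrite /r; lra.
have z0in : cmod (z0 - z0) < rho by rewrite subrr cmod0.
have [|||p pr pmin] := @compact_min _ [set z : C | cmod (z - z0) = r] (fun z => cmod (f z - f z0)).
- exact: compact_circle.
- by exists (z0 + toC r); rewrite /= cmod_sub_toC// ltW.
- move=> z /= zr; apply: continuous_at_cmod; apply: continuous_atB; last exact: continuous_at_cst.
  by apply/derivable_continuous_at/df; rewrite zr.
pose c := cmod (f p - f z0).
have c0 : 0 < c.
  rewrite cmod_gt0 subr_eq0; apply/eqP => fp.
  have pz : p = z0 by apply: finj => //; rewrite pr.
  by move: pr r0; rewrite pz /= subrr cmod0 => <-; rewrite ltxx.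
pose k := c / (4 * r).
have k0 : 0 < k by rewrite divr_gt0// mulr_gt0.
have [d' d'0 dH] := qc _ k0.
(* Within [del] of [z0] the slope of [f] at [z0] is below [k]. *)
pose del := Num.min d' (r / 2).
have del0 : 0 < del by rewrite lt_min d'0 divr_gt0.
have del1 : del <= d' by rewrite ge_min lexx.
have del2 : del <= r / 2 by rewrite ge_min lexx orbT.
have flat z2 : cmod (z2 - z0) < del -> z2 != z0 -> has_derivative f z2 0.
  move=> z2del z20.
  have n0 : 0 < cmod (z2 - z0) by rewrite cmod_gt0 subr_eq0.
  have z2in : cmod (z2 - z0) < rho by lra.
  have qz2 : cmod (q z2) < k.
    by have := dH z2; rewrite qd d0 subr0; apply; exact: lt_le_trans del1.
  have near0 : cmod (f z2 - f z0) < k * cmod (z2 - z0).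
    by rewrite fq cmodM ltr_pM2r.
  have [d2 hd2] := (derivableP_slope f z2).1 (df _ z2in).
  have [<-//|d20] := eqVneq d2 0.
  exfalso; move: hd2 => [q2 [cq2 q2z fq2]].
  have q20 z : cmod (z - z0) < rho -> q2 z != 0.
    move=> zin; have [->|zz2] := eqVneq z z2; first by rewrite q2z.
    apply/eqP => q0; move/eqP: zz2; apply; apply: finj => //.
    by apply/eqP; rewrite -subr_eq0 fq2 q0 mul0r.
  have dq2 z : cmod (z - z0) < rho -> z != z2 -> derivable q2 z 1.
    by move=> zin zz2; apply: slope_derivable fq2 zz2 (df _ zin).
  have cq z : cmod (z - z0) < rho -> {for z, continuous q2}.
    move=> zin; have [->|zz2] := eqVneq z z2; first exact: cq2.
    exact/derivable_continuous_at/dq2.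
  have M : forall z, cmod (z - z0) <= r -> cmod ((q2 z)^-1) <= k^-1.
    apply: (@max_disk_except _ (fun z => (q2 z)^-1) z0 z2 r k^-1 r0).
    - by move=> z zr; apply: continuous_atV; [apply: q20; lra|apply: cq; lra].
    - by move=> z zr zz2; apply: holoV; [apply: q20; lra|apply: dq2 => //; lra].
    - move=> z zr; rewrite cmodV lef_pV2 ?posrE ?cmod_gt0 ?q20 ?zr//.
      have zz2 : cmod (z - z2) <= 2 * r.
        have -> : z - z2 = (z - z0) - (z2 - z0) by ring.
        by apply: le_trans (cmodD _ _) _; rewrite cmodN zr; lra.
      have fz2 : cmod (f z2 - f z0) <= c / 4.
        apply: le_trans (ltW near0) _.
        have -> : c / 4 = k * r by rewrite /k; field; rewrite gt_eqF.
        by apply: ler_wpM2l; [exact: ltW|lra].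
      have fz : c <= cmod (f z - f z0) by exact: pmin.
      have : c / 2 <= cmod (f z - f z2).
        have := cmodD (f z - f z2) (f z2 - f z0); rewrite addrA subrK.
        by lra.
      rewrite fq2 cmodM => h.
      have h2 : cmod (q2 z) * cmod (z - z2) <= cmod (q2 z) * (2 * r).
        by apply: ler_wpM2l => //; exact: cmod_ge0.
      rewrite /k ler_pdivrMr; last by lra.
      by lra.
  have := M z0; rewrite subrr cmod0 => /(_ (ltW r0)).
  rewrite cmodV lef_pV2 ?posrE ?cmod_gt0 ?q20// => h.
  move: near0; rewrite cmod_distC fq2 cmodM (cmod_distC z0) ltr_pM2r//.
  by rewrite ltNge h.
pose z1 := z0 + toC (del / 2).
have cz1 : cmod (z1 - z0) = del / 2 by rewrite cmod_sub_toC// divr_ge0// ltW.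
have segin t : 0 <= t <= 1 -> cmod (seg z0 z1 t - z0) <= del / 2.
  move=> /andP[t0 t1]; rewrite /seg addrAC subrr add0r cmodM cmod_toC cz1 ger0_norm//.
  by rewrite -[leRHS]mul1r; apply: ler_wpM2r => //; lra.
have : f z0 = f z1.
  apply: eq_of_derivative0 => t tin.
    apply: flat.
      apply: (@le_lt_trans _ _ (del / 2)); last by lra.
      by apply: segin; lra.
    rewrite -subr_eq0 /seg addrAC subrr add0r -cmod_gt0 cmodM cmod_toC cz1.
    by rewrite mulr_gt0 ?divr_gt0// normr_gt0; lra.
  by apply/derivable_continuous_at/df; apply: le_lt_trans (segin _ tin) _; lra.
move/finj => /(_ z0in); rewrite cz1 => h.
have /h z01 : del / 2 < rho by lra.
by move: cz1; rewrite -z01 subrr cmod0; lra.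
Qed.

(** Maximum principle for [F z / z], extended continuously at the origin, on the disks
    of radius [r < 1]. *)
Lemma schwarz F : (forall z, cmod z < 1 -> derivable F z 1) ->
  (forall z, cmod z < 1 -> cmod (F z) < 1) -> F 0 = 0 ->
  forall z, cmod z < 1 -> cmod (F z) <= cmod z.
Proof.
move=> dF Fin F0 z z1.
have dF0 : derivable F 0 1 by apply: dF; rewrite cmod0.
have [q qc Fq] := derivable_slope dF0.
have FE w : F w = q w * w by have := Fq w; rewrite F0 !subr0.
have dq w : cmod w < 1 -> w != 0 -> derivable q w 1.
  by move=> w1 w0; apply: slope_derivable Fq w0 (dF _ w1).
have cq w : cmod w < 1 -> {for w, continuous q}.
  by move=> w1; have [->//|w0] := eqVneq w 0; exact/derivable_continuous_at/dq.
have bd r : cmod z < r -> r < 1 -> cmod (F z) * r <= cmod z.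
  move=> zr r1; have r0 : 0 < r by apply: le_lt_trans zr; exact: cmod_ge0.
  rewrite FE cmodM -mulrA (mulrC (cmod z)) mulrA ler_piMl ?cmod_ge0//.
  rewrite -ler_pdivlMr// mul1r.
  apply: (@max_disk_except _ q 0 0 r _ r0).
  - by move=> w; rewrite subr0 => wr; apply: cq; lra.
  - by move=> w; rewrite subr0 => wr w0; apply: dq => //; lra.
  - move=> w; rewrite subr0 => wr; rewrite -[r^-1]mul1r ler_pdivlMr// -wr -cmodM -FE.
    by apply/ltW/Fin; rewrite wr.
  - by rewrite subr0 ltW.
rewrite leNgt; apply/negP => zF.
have F0' : 0 < cmod (F z) by apply: le_lt_trans zF; exact: cmod_ge0.
pose u := cmod z / cmod (F z).
have u1 : u < 1 by rewrite ltr_pdivrMr// mul1r.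
pose r := Num.max ((1 + cmod z) / 2) ((1 + u) / 2).
have r1 : r < 1 by rewrite gt_max; apply/andP; split; lra.
have ra : (1 + cmod z) / 2 <= r by rewrite le_max lexx.
have rb : (1 + u) / 2 <= r by rewrite le_max lexx orbT.
have zr : cmod z < r by lra.
have := bd r zr r1; rewrite mulrC -ler_pdivlMr// -/u; lra.
Qed.

(** If the derivative [d] were nonzero, moving [z] in the direction [g z / d] would
    increase the modulus of [g] to first order. *)
Lemma cst_modulus_derive0 g z : derivable g z 1 -> (\forall w \near z, cmod (g w) = 1) ->
  has_derivative g z 0.
Proof.
move=> /derivableP_slope[d [p [pc pd gp]]] /nbhsP[e e0 g1].
have [d0|d0] := eqVneq d 0; first by exists p; rewrite -d0.
exfalso; pose h := g z / d.
have gz : cmod (g z) = 1 by apply: g1; rewrite subrr cmod0.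
have h0 : 0 < cmod h by rewrite cmodM cmodV gz mul1r invr_gt0 cmod_gt0.
move/continuous_atP : pc => /(_ (cmod h)^-1); rewrite invr_gt0 => /(_ h0)[r r0 rH].
(* The step [t] is small enough to stay where [|g| = 1] and [p] is close to [d]. *)
pose t := Num.min (e / (2 * cmod h)) (r / (2 * cmod h)).
have h20 : 0 < 2 * cmod h by lra.
have t0 : 0 < t by rewrite lt_min !divr_gt0.
have te : t * (2 * cmod h) <= e by rewrite -ler_pdivlMr// ge_min lexx.
have tr : t * (2 * cmod h) <= r by rewrite -ler_pdivlMr// ge_min lexx orbT.
pose w := z + toC t * h.
have wz : w - z = toC t * h by rewrite /w addrAC subrr add0r.
have cwz : cmod (w - z) = t * cmod h by rewrite wz cmodM cmod_toC gtr0_norm.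
have th : 0 < t * cmod h by rewrite mulr_gt0.
have gw1 : cmod (g w) = 1 by apply: g1; rewrite cwz; lra.
have pw : cmod (p w - p z) < (cmod h)^-1 by apply: rH; rewrite cwz; lra.
have E : toC (1 + t) * g z = g w - (p w - p z) * (w - z).
  rewrite mulrBl -gp pd wz /h toCD; field.
  exact: d0.
have := congr1 (@cmod R) E; rewrite cmodM cmod_toC gz mulr1 gtr0_norm; last by lra.
move=> E2; have := cmodD (g w) (- ((p w - p z) * (w - z))).
rewrite -E2 cmodN gw1 cmodM cwz.
have : cmod (p w - p z) * (t * cmod h) < (cmod h)^-1 * (t * cmod h) by rewrite ltr_pM2r.
rewrite [X in _ < X]mulrCA mulVf ?gt_eqF// mulr1.
lra.
Qed.

(** The quotient [F z / z] has modulus 1, hence zero derivative away from the origin. *)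
Lemma rotation F : (forall z, cmod z < 1 -> derivable F z 1) ->
  (forall z, cmod z < 1 -> cmod (F z) = cmod z) ->
  exists2 l, cmod l = 1 & forall z, cmod z < 1 -> F z = l * z.
Proof.
move=> dF Fiso.
have F0 : F 0 = 0.
  by apply/eqP; rewrite -cmod_eq0 Fiso cmod0.
have dF0 : derivable F 0 1 by apply: dF; rewrite cmod0.
have [q qc Fq] := derivable_slope dF0.
have FE w : F w = q w * w by have := Fq w; rewrite F0 !subr0.
have dq w : cmod w < 1 -> w != 0 -> derivable q w 1.
  by move=> w1 w0; apply: slope_derivable Fq w0 (dF _ w1).
have cq w : cmod w < 1 -> {for w, continuous q}.
  by move=> w1; have [->//|w0] := eqVneq w 0; exact/derivable_continuous_at/dq.
have q1 w : cmod w < 1 -> w != 0 -> cmod (q w) = 1.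
  move=> w1 w0; have := Fiso w w1; rewrite FE cmodM -{2}[cmod w]mul1r.
  by apply: mulIf; rewrite cmod_eq0.
have near1 w : cmod w < 1 -> w != 0 -> \forall v \near w, cmod (q v) = 1.
  move=> w1 w0; have /nbhsP[e e0 H] := near_neq w0.
  apply/nbhsP; exists (Num.min e (1 - cmod w)); first by rewrite lt_min e0 subr_gt0.
  move=> v; rewrite lt_min => /andP[/H v0 v1]; apply: q1 => //.
  have := cmod_dist v w; rewrite ler_norml => /andP[_]; move: v1; lra.
have qcst z : cmod z < 1 -> z != 0 -> q z = q 0.
  move=> z1 z0; apply/esym; apply: eq_of_derivative0 => t /andP[t0 t1].
    have sz : seg 0 z t = toC t * z by rewrite /seg add0r subr0.
    have s1 : cmod (seg 0 z t) < 1.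
      rewrite sz cmodM cmod_toC gtr0_norm//; apply: le_lt_trans z1.
      by rewrite -[leRHS]mul1r; apply: ler_wpM2r; [exact: cmod_ge0|exact: ltW].
    have s0 : seg 0 z t != 0.
      by rewrite sz mulf_neq0// -cmod_eq0 cmod_toC normr_eq0 gt_eqF.
    by apply: cst_modulus_derive0; [exact: dq|exact: near1].
  apply: cq; rewrite /seg add0r subr0 cmodM cmod_toC ger0_norm//; apply: le_lt_trans z1.
  by rewrite -[leRHS]mul1r; apply: ler_wpM2r; [exact: cmod_ge0|].
exists (q 0).
  have h1 : cmod (toC (1 / 2) : C) < 1 by rewrite cmod_toC ger0_norm; lra.
  have h0 : toC (1 / 2) != 0 :> C by rewrite -cmod_eq0 cmod_toC normr_eq0 gt_eqF ?divr_gt0.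
  by rewrite -(qcst _ h1 h0) q1.
move=> z z1; have [->|z0] := eqVneq z 0; first by rewrite F0 mulr0.
by rewrite FE qcst.
Qed.

End SchwarzLemma.

(** * Lifting maps through a covering by the disk *)

Section Lifting.
Variable R : realType.
Local Notation C := (Cplx R).
Implicit Types (f g h F phi : C -> C) (a b c z w d x y p q m : C) (D : set C).

(** Connectedness of the unit interval: a property whose truth value is locally
    constant is constant. *)
Lemma connected_unit (P : R -> Prop) :
  (forall t, 0 <= t <= 1 -> exists2 e : R, 0 < e & forall s s' : R,
     0 <= s <= 1 -> 0 <= s' <= 1 -> `|s - t| < e -> `|s' - t| < e -> P s -> P s') ->
  P 0 -> P 1.
Proof.
move=> H P0.
pose A : set R := [set t | 0 <= t <= 1 /\ forall s, 0 <= s <= t -> P s].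
have A0 : A 0.
  split; first by rewrite lexx ler01.
  by move=> s /andP[s1 s2]; have -> : s = 0 by lra.
have ubA : ubound A 1 by move=> t [/andP[]].
have t0 : 0 <= sup A by apply: ub_le_sup => //; exists 1.
have t1 : sup A <= 1 by apply: sup_le_ub => //; exists 0.
have [|e e0 He] := H (sup A); first by rewrite t0.
have [a [/andP[a0 a1] aP] ea] : exists2 a, A a & sup A - e < a.
  by apply: sup_adherent => //; split; [exists 0|exists 1].
have aA : a <= sup A by apply: ub_le_sup; [exists 1|split => //; apply/andP].
have near s : 0 <= s <= 1 -> `|s - sup A| < e -> P s.
  move=> s01 sA; apply: (He a) => //; first by apply/andP.
    by rewrite ltr_norml; apply/andP; split; lra.
  by apply: aP; rewrite a0 lexx.
have below s : 0 <= s <= 1 -> s < sup A + e -> P s.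
  move=> /andP[s0 s1] se; have [sa|sa] := leP s a; first by apply: aP; rewrite s0.
  by apply: near; [apply/andP|rewrite ltr_norml; apply/andP; split; lra].
have [big|small] := ltP 1 (sup A + e); first by apply: below; lra.
exfalso; have : A (sup A + e / 2).
  split; first by apply/andP; split; lra.
  by move=> s /andP[s0 se]; apply: below; [apply/andP; split; lra|lra].
move=> Ae; have : sup A + e / 2 <= sup A by apply: ub_le_sup; [exists 1|].
lra.
Qed.

Lemma seg_near c z (t d : R) : 0 < d ->
  exists2 e : R, 0 < e & forall s, `|s - t| < e -> cmod (seg c z s - seg c z t) < d.
Proof.
move=> d0; have k0 : 0 < cmod (z - c) + 1 by have := cmod_ge0 (z - c); lra.
exists (d / (cmod (z - c) + 1)); first exact: divr_gt0.
move=> s; rewrite ltr_pdivlMr// segB cmodM cmod_toC; apply: le_lt_trans.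
by apply: ler_wpM2l => //; lra.
Qed.

Lemma ball_convex p q m (r l : R) : cmod (p - m) < r -> cmod (q - m) < r ->
  0 <= l <= 1 -> cmod (seg p q l - m) < r.
Proof.
move=> pm qm /andP[l0 l1].
have -> : seg p q l - m = toC (1 - l) * (p - m) + toC l * (q - m).
  have -> : toC (1 - l) = 1 - toC l :> C by rewrite toCB.
  rewrite /seg; ring.
apply: le_lt_trans (cmodD _ _) _; rewrite !cmodM !cmod_toC !ger0_norm ?subr_ge0//.
have [->|ln0] := eqVneq l 0; first by rewrite subr0 mul1r mul0r addr0.
have l_gt0 : 0 < l by rewrite lt_neqAle eq_sym ln0.
have h1 : l * cmod (q - m) < l * r by rewrite ltr_pM2l.
have h2 : (1 - l) * cmod (p - m) <= (1 - l) * r by apply: ler_wpM2l; [lra|exact: ltW].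
have : (1 - l) * r + l * r = r by ring.
lra.
Qed.

Lemma disk_convex p q (l : R) : cmod p < 1 -> cmod q < 1 -> 0 <= l <= 1 ->
  cmod (seg p q l) < 1.
Proof. by have := @ball_convex p q 0 1 l; rewrite !subr0. Qed.

(** What is used of a holomorphic covering of [D] by the unit disk: [dc_section] gives
    the sheets over a small disk around [w] as continuous sections, [dc_inj] says that
    a sheet contains a neighbourhood of each of its points.  In this form the notion
    is visibly invariant under automorphisms of the disk. *)
Record disk_covering D phi := DiskCovering {
  dc_holo : forall z, cmod z < 1 -> derivable phi z 1;
  dc_into : forall z, cmod z < 1 -> D (phi z);
  dc_onto : forall w, D w -> exists2 z, cmod z < 1 & phi z = w;
  dc_inj : forall z, cmod z < 1 -> exists2 e : R, 0 < e & forall x y,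
    cmod x < 1 -> cmod y < 1 -> cmod (x - z) < e -> cmod (y - z) < e ->
    phi x = phi y -> x = y;
  dc_section : forall w, D w -> exists2 e : R, 0 < e & forall z,
    cmod z < 1 -> cmod (phi z - w) < e -> exists2 sg : C -> C, sg (phi z) = z &
    forall u, cmod (u - w) < e ->
      [/\ cmod (sg u) < 1, phi (sg u) = u & {for u, continuous sg}] }.

Variables (D : set C) (phi : C -> C).
Hypothesis cov : disk_covering D phi.

(** Two lifts of the same path agree on a set of parameters which is open because [phi]
    is locally injective, and closed because the plane is Hausdorff. *)
Lemma lift_unique F1 F2 p q : F1 p = F2 p ->
  (forall t, 0 <= t <= 1 -> [/\ {for seg p q t, continuous F1}, {for seg p q t, continuous F2},
     cmod (F1 (seg p q t)) < 1, cmod (F2 (seg p q t)) < 1 &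
     phi (F1 (seg p q t)) = phi (F2 (seg p q t))]) ->
  F1 q = F2 q.
Proof.
move=> F12 H; pose P t := F1 (seg p q t) = F2 (seg p q t).
suff : P 1 by rewrite /P seg1.
apply: connected_unit; last by rewrite /P seg0.
move=> t t01; have [/continuous_atP c1 /continuous_atP c2 b1 b2 _] := H t t01.
have [E|/eqP nE] := eqVneq (F1 (seg p q t)) (F2 (seg p q t)).
- have [e e0 inj] := dc_inj cov b1.
  have [d1 d10 dH1] := c1 _ e0; have [d2 d20 dH2] := c2 _ e0.
  have [r r0 rH] : exists2 r : R, 0 < r & forall s, `|s - t| < r ->
      cmod (seg p q s - seg p q t) < Num.min d1 d2.
    by apply: seg_near; rewrite lt_min d10.
  exists r => // s s' s01 s'01 _ /rH; rewrite lt_min => /andP[/dH1 h1 /dH2 h2] _.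
  have [_ _ b1' b2' E'] := H s' s'01.
  by apply: inj => //; rewrite E.
- pose e := cmod (F1 (seg p q t) - F2 (seg p q t)) / 2.
  have e0 : 0 < e by rewrite divr_gt0// cmod_gt0 subr_eq0; exact/eqP.
  have [d1 d10 dH1] := c1 _ e0; have [d2 d20 dH2] := c2 _ e0.
  have [r r0 rH] : exists2 r : R, 0 < r & forall s, `|s - t| < r ->
      cmod (seg p q s - seg p q t) < Num.min d1 d2.
    by apply: seg_near; rewrite lt_min d10.
  exists r => // s s' _ _ /rH + _ Ps; rewrite lt_min => /andP[/dH1 h1 /dH2 h2].
  exfalso; have := cmodD (F1 (seg p q t) - F1 (seg p q s)) (F2 (seg p q s) - F2 (seg p q t)).
  rewrite {1}Ps addrA subrK (cmod_distC _ (F1 (seg p q s))).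
  have : 2 * e = cmod (F1 (seg p q t) - F2 (seg p q t)) by rewrite /e; field.
  lra.
Qed.

Section Existence.
Variables (h : C -> C) (c w0 : C).
Hypothesis hc : forall z, cmod z < 1 -> {for z, continuous h}.
Hypothesis hD : forall z, cmod z < 1 -> D (h z).
Hypothesis c1 : cmod c < 1.
Hypothesis w01 : cmod w0 < 1.
Hypothesis hcw : phi w0 = h c.

(** Lifts are built on neighbourhoods of the initial parts of a segment issued from the
    base point [c], rather than on the segment only: continuity of the final lift then
    comes for free. *)
Definition tube z (s e : R) : set C :=
  [set x | cmod x < 1 /\ exists2 t, 0 <= t <= s & cmod (x - seg c z t) < e].

Definition is_lift (N : set C) F := forall x, N x ->
  [/\ {for x, continuous F}, cmod (F x) < 1 & phi (F x) = h x].

Lemma near_disk x : cmod x < 1 -> \forall y \near x, cmod y < 1.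
Proof.
move=> x1; apply/nbhsP; exists (1 - cmod x); first by rewrite subr_gt0.
by move=> y xy; have := cmodD (y - x) x; rewrite subrK; lra.
Qed.

Lemma near_ball x m (r : R) : cmod (x - m) < r -> \forall y \near x, cmod (y - m) < r.
Proof.
move=> xm; apply/nbhsP; exists (r - cmod (x - m)); first by rewrite subr_gt0.
by move=> y xy; have := cmodD (y - x) (x - m); rewrite addrA subrK; lra.
Qed.

Lemma near_tube z s e x : tube z s e x -> \forall y \near x, tube z s e y.
Proof.
move=> [x1 [t t01 xt]]; near=> y; split; first by near: y; exact: near_disk.
by exists t => //; near: y; exact: near_ball.
Unshelve. all: by end_near. Qed.

(** The points within [e] of a point of the segment are joined to its end point
    [seg c z s] without leaving the tube; this is the connectedness that makes local
    lifts glue. *)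
Lemma tube_star z s e y t l : cmod z < 1 -> 0 < e -> 0 <= s <= 1 -> 0 <= t <= s ->
  cmod y < 1 -> cmod (y - seg c z t) < e -> 0 <= l <= 1 ->
  tube z s e (seg (seg c z s) y l).
Proof.
move=> z1 e0 /andP[s0 s1] /andP[t0 ts] y1 yt l01; split.
  by apply: disk_convex => //; apply: disk_convex => //; apply/andP.
move/andP: (l01) => [l0 l1].
have lst : 0 <= l * (s - t) by rewrite mulr_ge0// subr_ge0.
have lst2 : l * (s - t) <= s - t by rewrite -[leRHS]mul1r ler_wpM2r// subr_ge0.
exists (s + l * (t - s)); first by apply/andP; split; lra.
have -> : seg (seg c z s) y l - seg c z (s + l * (t - s)) = toC l * (y - seg c z t).
  by rewrite /seg toCD toCM toCB; ring.
rewrite cmodM cmod_toC ger0_norm//; apply: le_lt_trans yt.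
by rewrite -[leRHS]mul1r ler_wpM2r// cmod_ge0.
Qed.

(** Near the parameter [t] the lift is continued by the section of [phi] over a
    neighbourhood of [h (seg c z t)] that agrees with it at [seg c z s]; both agree on
    the overlap by [tube_star] and uniqueness. *)
Lemma lift_step z t : cmod z < 1 -> 0 <= t <= 1 -> exists2 r : R, 0 < r & forall s s',
  0 <= s <= 1 -> 0 <= s' <= 1 -> `|s - t| < r -> `|s' - t| < r ->
  (exists2 e : R, 0 < e & exists2 F, is_lift (tube z s e) F & F c = w0) ->
  exists2 e : R, 0 < e & exists2 F, is_lift (tube z s' e) F & F c = w0.
Proof.
move=> z1 t01; set m := seg c z t.
have m1 : cmod m < 1 by exact: disk_convex.
have [e e0 sec] := dc_section cov (hD m1).
have /continuous_atP/(_ e e0)[d d0 dH] := hc m1.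
have d20 : 0 < d / 2 by rewrite divr_gt0.
have [r r0 rH] := seg_near c z t d20.
exists r => // s s' s01 s'01 st s't [eps eps0 [F lF Fc]].
have sm : cmod (seg c z s - m) < d by apply: lt_trans (rH _ st) _; lra.
have s1 : cmod (seg c z s) < 1 by exact: disk_convex.
have sin : tube z s eps (seg c z s).
  split=> //; exists s; first by rewrite lexx; case/andP: s01 => ->.
  by rewrite subrr cmod0.
have [Fsc Fs1 Fsh] := lF _ sin.
have [|sg sgs sgP] := sec _ Fs1; first by rewrite Fsh; exact: dH.
have lG x : cmod x < 1 -> cmod (x - m) < d ->
    [/\ {for x, continuous (fun y => sg (h y))}, cmod (sg (h x)) < 1 & phi (sg (h x)) = h x].
  move=> x1 xm; have [p1 p2 p3] := sgP _ (dH _ xm).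
  by split; [apply: continuous_at_comp p3; exact: hc|exact: p1|exact: p2].
(* The two partial lifts agree where both are defined. *)
have overlap y : tube z s eps y -> cmod (y - m) < d -> F y = sg (h y).
  move=> [y1 [u us yu]] ym; apply: (@lift_unique F (fun y => sg (h y)) (seg c z s) y).
    by rewrite -Fsh sgs.
  move=> l l01.
  have [p1 p2 p3] := lF _ (tube_star z1 eps0 s01 us y1 yu l01).
  have [|| q1 q2 q3] := lG (seg (seg c z s) y l).
  - exact: disk_convex.
  - exact: ball_convex.
  - by split; [exact: p1|exact: q1|exact: p2|exact: q2|rewrite p3 q3].
pose F' x := if `[< tube z s eps x >] then F x else sg (h x).
have F'F x : tube z s eps x -> F' x = F x by move=> xt; rewrite /F' asboolT.
have F'G x : cmod (x - m) < d -> F' x = sg (h x).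
  move=> xm; have [xt|xt] := pselect (tube z s eps x).
    by rewrite F'F// overlap.
  by rewrite /F' asboolF.
exists (Num.min eps (d / 2)); first by rewrite lt_min eps0.
exists F'; last first.
  rewrite F'F//; split => //; exists 0; last by rewrite seg0 subrr cmod0.
  by rewrite lexx; case/andP: s01 => ->.
move=> x [x1 [u /andP[u0 us'] xu]].
have := xu; rewrite lt_min => /andP[xu1 xu2].
have [us|us] := leP u s.
- have xt : tube z s eps x by split => //; exists u => //; apply/andP.
  have [p1 p2 p3] := lF _ xt; rewrite (F'F _ xt); split; [|exact: p2|exact: p3].
  apply: continuous_at_near p1; near=> y; apply/esym/F'F.
  by near: y; exact: near_tube.
- have ut : `|u - t| < r.
    move: st s't; rewrite !ltr_norml => /andP[? ?] /andP[? ?].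
    by apply/andP; split; lra.
  have xm : cmod (x - m) < d.
    have := cmodD (x - seg c z u) (seg c z u - m); rewrite addrA subrK.
    by have := rH _ ut; rewrite -/m; lra.
  have [p1 p2 p3] := lG _ x1 xm; rewrite (F'G _ xm); split; [|exact: p2|exact: p3].
  apply: continuous_at_near p1; near=> y; apply/esym/F'G.
  by near: y; exact: near_ball.
Unshelve. all: by end_near. Qed.

Lemma lift_start z : exists2 e : R, 0 < e & exists2 F, is_lift (tube z 0 e) F & F c = w0.
Proof.
have [e e0 sec] := dc_section cov (hD c1).
have /continuous_atP/(_ e e0)[d d0 dH] := hc c1.
have [|sg sgw sgP] := sec _ w01; first by rewrite hcw subrr cmod0.
exists d => //; exists (fun x => sg (h x)); last by rewrite -hcw.
move=> x [x1 [t /andP[t0 t1]]]; have -> : t = 0 by lra.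
rewrite seg0 => /dH /sgP[p1 p2 p3].
by split; [apply: continuous_at_comp p3; exact: hc|exact: p1|exact: p2].
Qed.

(** The value at [z] is that of a lift on a tube around the segment from [c] to [z].
    For [z] near [z0], the tube around the segment to [z0] contains the segment to [z],
    so by uniqueness the lift attached to [z0] also computes the value at [z]. *)
Lemma lift_exists : exists2 F, F c = w0 & forall z, cmod z < 1 ->
  [/\ {for z, continuous F}, cmod (F z) < 1 & phi (F z) = h z].
Proof.
have /choice[G GP] : forall z, exists p : R * (C -> C), cmod z < 1 ->
    [/\ 0 < p.1, is_lift (tube z 1 p.1) p.2 & p.2 c = w0].
  move=> z; have [z1|z1] := pselect (cmod z < 1); last by exists (0, fun=> 0).
  have [e e0 [F lF Fc]] : exists2 e : R, 0 < e & exists2 F, is_lift (tube z 1 e) F & F c = w0.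
    apply: (@connected_unit (fun s => exists2 e : R, 0 < e & exists2 F,
      is_lift (tube z s e) F & F c = w0)); last exact: lift_start.
    by move=> t t01; exact: lift_step.
  by exists (e, F).
pose F z := (G z).2 z.
have same z0 z : cmod z0 < 1 -> cmod z < 1 -> cmod (z - z0) < (G z0).1 -> F z = (G z0).2 z.
  move=> z01 z1 zz0; have [e0 l0 g0] := GP _ z01; have [e1 l1 g1] := GP _ z1.
  apply: (@lift_unique (G z).2 (G z0).2 c z); first by rewrite g0 g1.
  move=> l l01; have s1 : cmod (seg c z l) < 1 by exact: disk_convex.
  have [|p1 p2 p3] := l1 (seg c z l).
    by split => //; exists l => //; rewrite subrr cmod0.
  have [|q1 q2 q3] := l0 (seg c z l).
    split => //; exists l => //.
    have -> : seg c z l - seg c z0 l = toC l * (z - z0) by rewrite /seg; ring.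
    case/andP: l01 => l_0 l_1.
    rewrite cmodM cmod_toC ger0_norm//; apply: le_lt_trans zz0.
    by rewrite -[leRHS]mul1r ler_wpM2r// cmod_ge0.
  by split; [exact: p1|exact: q1|exact: p2|exact: q2|rewrite p3 q3].
exists F; first by have [_ _] := GP _ c1.
move=> z z1; have [e0 l0 g0] := GP _ z1.
have zt : tube z 1 (G z).1 z.
  by split => //; exists 1; rewrite ?seg1 ?subrr ?cmod0// ler01 lexx.
have [p1 p2 p3] := l0 _ zt; rewrite /F; split; [|exact: p2|exact: p3].
apply: continuous_at_near p1; near=> y; apply/esym/same => //.
  by near: y; exact: near_disk.
by near: y; apply: near_ball; rewrite subrr cmod0.
Unshelve. all: by end_near. Qed.

End Existence.

Lemma covering_derivative z d : cmod z < 1 -> has_derivative phi z d -> d != 0.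
Proof.
move=> z1 hd; have [e e0 inj] := dc_inj cov z1.
have r0 : 0 < Num.min e (1 - cmod z) by rewrite lt_min e0 subr_gt0.
have bd w : cmod (w - z) < Num.min e (1 - cmod z) -> cmod w < 1 /\ cmod (w - z) < e.
  rewrite lt_min => /andP[h1 h2]; split => //.
  by have := cmodD (w - z) z; rewrite subrK; lra.
apply: (injective_derivative_neq0 r0 _ _ hd).
- by move=> w /bd[w1 _]; exact: (dc_holo cov).
- by move=> x y /bd[x1 xe] /bd[y1 ye]; exact: inj.
Qed.

(** The slope of [F] is the quotient of the slopes of [h] and [phi], the latter being
    nonzero by [covering_derivative]. *)
Lemma lift_derivable h F z : cmod z < 1 -> {for z, continuous F} -> cmod (F z) < 1 ->
  (\forall y \near z, phi (F y) = h y) -> derivable h z 1 -> derivable F z 1.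
Proof.
move=> z1 cF Fz1 lift dh.
have [d hd] := (derivableP_slope phi (F z)).1 (dc_holo cov Fz1).
have d0 := covering_derivative Fz1 hd.
have [q [cq qd phiq]] := hd.
have [p cp hp] := derivable_slope dh.
have cqF : {for z, continuous (fun y => q (F y))} by exact: continuous_at_comp cF cq.
apply/derivableP_slope; exists (p z / d).
apply: (@has_derivative_near _ F z _ (fun y => p y * (q (F y))^-1)).
- by apply: continuous_atM cp _; apply: continuous_atV cqF; rewrite qd.
- by rewrite qd.
have /nbhsP[e e0 eP] := lift.
have /continuous_atP/(_ (cmod d))[] := cqF; first by rewrite cmod_gt0.
move=> r r0 rH; apply/nbhsP; exists (Num.min e r); first by rewrite lt_min e0.
move=> y; rewrite lt_min => /andP[ye yr].
have qy : q (F y) != 0.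
  by apply/eqP => q0; have := rH _ yr; rewrite q0 qd sub0r cmodN ltxx.
have hz : phi (F z) = h z by apply: eP; rewrite subrr cmod0.
have := hp y; rewrite -(eP _ ye) -hz phiq => E.
by rewrite mulrAC -E mulrC mulKf.
Qed.

End Lifting.

(** * Universal coverings of planar domains *)

Section Coverings.
Variable R : realType.
Local Notation C := (Cplx R).
Implicit Types (f g h F phi : C -> C) (a b c z w d x y : C) (D : set C).

Lemma unit_diskE z : unit_disk z = (cmod z < 1) :> Prop.
Proof.
rewrite /unit_disk /= normE -toC_lt.
by have -> : toC 1 = 1 :> C by rewrite /toC rmorph1.
Qed.

Lemma covering_charts D phi : holomorphic_covering (@unit_disk R) D phi -> disk_covering D phi.
Proof.
move=> [hol onto ev].
have into z : cmod z < 1 -> D (phi z).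
  by move=> z1; rewrite -onto; exists z => //; rewrite unit_diskE.
split=> //.
- by move=> z z1; apply: hol; rewrite unit_diskE.
- by move=> w; rewrite -onto => -[z]; rewrite unit_diskE => z1 <-; exists z.
- move=> z z1; have [U [oU UD Uz [F [EF _ FP]]]] := ev _ (into _ z1).
  have : (@unit_disk R `&` phi @^-1` U) z by split; rewrite ?unit_diskE.
  rewrite EF => -[V FV Vz]; have [oV [[_ inj _] _ _]] := FP _ FV.
  have : nbhs z V by exact: open_nbhs_nbhs.
  move=> /nbhsP[e e0 eV]; exists e => // x y _ _ /eV Vx /eV Vy; apply: inj; exact/mem_set.
- move=> w Dw; have [U [oU UD Uw [F [EF _ FP]]]] := ev _ Dw.
  have : nbhs w U by exact: open_nbhs_nbhs.
  move=> /nbhsP[e e0 eU]; exists e => // z z1 /eU Uz.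
  have : (@unit_disk R `&` phi @^-1` U) z by split; rewrite ?unit_diskE.
  rewrite EF => -[V FV Vz]; have [oV [[_ _ surj] _ [g cg gphi]]] := FP _ FV.
  exists g; first exact: gphi.
  move=> u ue; have Uu := eU _ ue; have [v Vv vu] := surj _ Uu.
  have gu : g u = v by rewrite -vu gphi.
  have : (@unit_disk R `&` phi @^-1` U) v by rewrite EF; exists V.
  case; rewrite unit_diskE => v1 _; split; [by rewrite gu|by rewrite gu|].
  move: cg; rewrite continuous_open_subspace// => /(_ u (mem_set Uu)).
  exact.
Qed.

Definition cconj z : C := conjc z.

Lemma cconjM a : cconj a * a = toC (cmod a ^+ 2).
Proof.
rewrite cmod_sqr; case: a => x y; apply/eqP; rewrite eq_complex /=.
by apply/andP; split; apply/eqP; ring.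
Qed.

Lemma cmod_cconj a : cmod (cconj a) = cmod a.
Proof. by case: a => x y; rewrite /cmod /= sqrrN. Qed.

Definition mobius a z : C := (z + a) / (1 + cconj a * z).

Lemma mobius_den a z : cmod a < 1 -> cmod z < 1 -> 1 + cconj a * z != 0.
Proof.
move=> a1 z1; apply/eqP => E.
have : cmod (cconj a * z) = 1.
  have -> : cconj a * z = - 1 by apply/eqP; rewrite -addr_eq0 addrC E.
  by rewrite cmodN cmod1.
have := cmod_ge0 z; have := cmod_ge0 a.
rewrite cmodM cmod_cconj; move: (cmod a) (cmod z) a1 z1 => r s r1 s1; nra.
Qed.

(** The difference of the squared moduli of the denominator and of the numerator is
    [(1 - |a|^2) (1 - |z|^2)]. *)
Lemma mobius_in a z : cmod a < 1 -> cmod z < 1 -> cmod (mobius a z) < 1.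
Proof.
move=> a1 z1; have d0 := mobius_den a1 z1.
rewrite /mobius cmodM cmodV ltr_pdivrMr ?cmod_gt0// mul1r.
rewrite -(@ltr_pXn2r _ 2)// ?nnegrE ?cmod_ge0//.
have E : cmod (1 + cconj a * z) ^+ 2 - cmod (z + a) ^+ 2 = (1 - cmod a ^+ 2) * (1 - cmod z ^+ 2).
  by rewrite !cmod_sqr; case: a {a1 d0} => x y; case: z {z1} => u v /=; ring.
rewrite -subr_gt0 E mulr_gt0// subr_gt0 expr_lt1 ?cmod_ge0//.
Qed.

Lemma cconjN a : cconj (- a) = - cconj a. Proof. by case: a. Qed.

Lemma mobiusK a z : cmod a < 1 -> cmod z < 1 -> mobius (- a) (mobius a z) = z.
Proof.
move=> a1 z1; have d0 := mobius_den a1 z1.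
have a0 : 1 - cconj a * a != 0.
  rewrite cconjM; apply/eqP => /(congr1 (@complex.Re R)) /= /eqP.
  by rewrite subr_eq0 eq_sym lt_eqF// expr_lt1 ?cmod_ge0.
have e1 : mobius a z + - a = z * (1 - cconj a * a) / (1 + cconj a * z).
  by rewrite /mobius; field.
have e2 : 1 + cconj (- a) * mobius a z = (1 - cconj a * a) / (1 + cconj a * z).
  by rewrite /mobius cconjN; field.
rewrite {1}/mobius e1 e2; field.
by rewrite d0 a0.
Qed.

Lemma mobius_derivable a z : cmod a < 1 -> cmod z < 1 -> derivable (mobius a) z 1.
Proof.
move=> a1 z1; apply: holoM; first by apply: holoD; [exact: holo_id|exact: holo_cst].
apply: holoV; first exact: mobius_den.
by apply: holoD; [exact: holo_cst|apply: holoM; [exact: holo_cst|exact: holo_id]].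
Qed.

Lemma disk_covering_mobius D phi a : cmod a < 1 -> disk_covering D phi ->
  disk_covering D (fun z => phi (mobius a z)).
Proof.
move=> a1 cov.
have b1 : cmod (- a) < 1 by rewrite cmodN.
have K' z : cmod z < 1 -> mobius a (mobius (- a) z) = z.
  by move=> z1; rewrite -{1}[a]opprK mobiusK.
split.
- move=> z z1; apply: derivable_comp1; first exact: mobius_derivable.
  by apply: (dc_holo cov); exact: mobius_in.
- by move=> z z1; apply: (dc_into cov); exact: mobius_in.
- move=> w /(dc_onto cov)[z z1 zw]; exists (mobius (- a) z); first exact: mobius_in.
  by rewrite K'.
- move=> z z1; have [e e0 inj] := dc_inj cov (mobius_in a1 z1).
  have /continuous_atP/(_ e e0)[d d0 dH] := derivable_continuous_at (mobius_derivable a1 z1).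
  exists d => // x y x1 y1 /dH xz /dH yz E.
  rewrite -(mobiusK a1 x1) -(mobiusK a1 y1); congr (mobius _ _).
  by apply: inj => //; exact: mobius_in.
- move=> w /(dc_section cov)[e e0 sec]; exists e => // z z1 zw.
  have [sg sgz sgP] := sec _ (mobius_in a1 z1) zw.
  exists (fun u => mobius (- a) (sg u)); first by rewrite sgz mobiusK.
  move=> u /sgP[p1 p2 p3]; split; [exact: mobius_in|by rewrite K'|].
  by apply: continuous_at_comp p3 _; exact/derivable_continuous_at/mobius_derivable.
Qed.

Lemma disk_covering_at D phi w : disk_covering D phi -> D w ->
  exists2 psi, disk_covering D psi & psi 0 = w.
Proof.
move=> cov /(dc_onto cov)[a a1 <-]; exists (fun z => phi (mobius a z)).
  exact: disk_covering_mobius.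
by rewrite /mobius add0r mulr0 addr0 divr1.
Qed.

(** If [psi z = psi w], lifting [psi] through itself gives a deck transformation [F]
    with [F z = w].  It fixes the origin, the only point of its fibre, so it is the
    identity. *)
Lemma trivial_fibre_injective D psi : disk_covering D psi ->
  (forall z, cmod z < 1 -> psi z = psi 0 -> z = 0) ->
  forall z w, cmod z < 1 -> cmod w < 1 -> psi z = psi w -> z = w.
Proof.
move=> cov triv z w z1 w1 zw.
have [||F Fz FP] := @lift_exists R D psi cov psi z w _ _ z1 w1 (esym zw).
- by move=> x x1; exact/derivable_continuous_at/(dc_holo cov).
- by move=> x x1; exact: (dc_into cov).
have o1 : cmod (0 : C) < 1 by rewrite cmod0.
have F0 : F 0 = 0 by have [_ h1 h2] := FP _ o1; exact: triv.
rewrite -Fz; apply/esym; apply: (lift_unique cov (F1 := F) (F2 := fun x => x) F0).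
move=> t t01; have s1 : cmod (seg 0 z t) < 1 by exact: disk_convex.
by have [p1 p2 p3] := FP _ s1; split; [exact: p1|exact: continuous_at_id|exact: p2|exact: s1|exact: p3].
Qed.

(** Such a covering is a homeomorphism onto [D] with inverse [k], and paths and
    contractions are transported from the convex unit disk. *)
Lemma injective_simply_connected D psi : disk_covering D psi ->
  (forall z w, cmod z < 1 -> cmod w < 1 -> psi z = psi w -> z = w) ->
  simply_connected D.
Proof.
move=> cov inj.
have /choice[k kP] : forall w, exists z, D w -> cmod z < 1 /\ psi z = w.
  move=> w; have [Dw|nD] := pselect (D w); last by exists 0.
  by have [z z1 zw] := dc_onto cov Dw; exists z.
have ck w : D w -> {for w, continuous k}.
  move=> Dw; have [e e0 sec] := dc_section cov Dw; have [k1 k2] := kP _ Dw.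
  have [|sg _ sgP] := sec _ k1; first by rewrite k2 subrr cmod0.
  have [_ _ csg] : [/\ cmod (sg w) < 1, psi (sg w) = w & {for w, continuous sg}].
    by apply: sgP; rewrite subrr cmod0.
  apply: continuous_at_near csg; apply/nbhsP; exists e => // u /sgP[p1 p2 _].
  have Du : D u by rewrite -p2; exact: (dc_into cov).
  by have [q1 q2] := kP _ Du; apply: inj => //; rewrite p2 q2.
have cpsi z : cmod z < 1 -> {for z, continuous psi}.
  by move=> z1; exact/derivable_continuous_at/(dc_holo cov).
split.
- move=> a b Da Db; exists (fun t => psi (seg (k a) (k b) t)).
  have [ka1 ka2] := kP _ Da; have [kb1 kb2] := kP _ Db.
  split; rewrite ?seg0 ?seg1//.
  + apply: continuous_in_subspaceT => t /set_mem; rewrite /unit_interval /= in_itv/= => t01 P.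
    by move=> /(cpsi _ (disk_convex ka1 kb1 t01)); exact: seg_continuous.
  + move=> t; rewrite /unit_interval /= in_itv/= => t01.
    by apply: (dc_into cov); exact: disk_convex.
- move=> a g [cg gD g0 g1].
  have I01 t : unit_interval t <-> 0 <= t <= 1 by rewrite /unit_interval /= in_itv.
  have Da : D a by rewrite -g0; apply: gD; apply/I01; rewrite lexx ler01.
  have [ka1 ka2] := kP _ Da.
  have kg t : unit_interval t -> cmod (k (g t)) < 1 /\ psi (k (g t)) = g t.
    by move=> /gD/kP.
  exists (fun st => psi (seg (k (g st.2)) (k a) st.1)); split.
  + apply/subspace_continuousP => -[s t] [/= Is It] P.
    move: (Is); rewrite I01 => s01; have [kt1 kt2] := kg _ It.
    move=> /(cpsi _ (disk_convex kt1 ka1 s01)) /nbhsP[d d0 dP].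
    have d20 : 0 < d / 2 by rewrite divr_gt0.
    have := proj1 (subspace_continuousP _ _) cg t It.
    have kgt : nbhs (g t) [set w | cmod (k w - k (g t)) < d / 2].
      have /continuous_atP/(_ _ d20)[r r0 rH] := ck _ (gD _ It).
      by apply/nbhsP; exists r.
    move=> /(_ _ kgt) /= /nbhs_ballP[r /= r0 rH].
    pose M := cmod (k a - k (g t)) + 1.
    have M0 : 0 < M by have := cmod_ge0 (k a - k (g t)); rewrite /M; lra.
    apply/nbhs_ballP; exists (Num.min r (d / 2 / M)).
      by rewrite /= lt_min r0 divr_gt0.
    move=> [s' t'] [/= bs bt] [/= Is' It']; apply: dP.
    have tt' : cmod (k (g t') - k (g t)) < d / 2.
      apply: rH => //; move: bt; rewrite /ball/= lt_min => /andP[]//.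
    have ss' : `|s' - s| * M < d / 2.
      by move: bs; rewrite /ball/= lt_min distrC => /andP[_]; rewrite ltr_pdivlMr.
    have -> : seg (k (g t')) (k a) s' - seg (k (g t)) (k a) s =
        toC (1 - s') * (k (g t') - k (g t)) + toC (s' - s) * (k a - k (g t)).
      have -> : toC (1 - s') = 1 - toC s' :> C by rewrite toCB.
      by rewrite toCB /seg; ring.
    move: Is'; rewrite I01 => /andP[s0 s1].
    apply: le_lt_trans (cmodD _ _) _; rewrite !cmodM !cmod_toC.
    have -> : d = d / 2 + d / 2 by field.
    apply: ltrD.
      apply: le_lt_trans tt'; rewrite ger0_norm ?subr_ge0// -[leRHS]mul1r.
      by rewrite ler_wpM2r ?cmod_ge0//; lra.
    apply: le_lt_trans ss'; apply: ler_wpM2l => //; rewrite /M; lra.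
  + move=> [s t] [/= /I01 s01 It]; apply: (dc_into cov).
    by apply: disk_convex => //; have [] := kg _ It.
  + by move=> t It; rewrite /= seg0 seg1 ka2; have [_ ->] := kg _ It.
  + by move=> s Is; rewrite /= g0 g1 /seg subrr mulr0 addr0.
Qed.

End Coverings.

(** * Finite groups of scalars are cyclic *)

Section FiniteSubgroupsOfFields.
Variables (G : groupType) (K : fieldType) (lam : G -> K).
Hypothesis lamM : forall x y, lam (x * y)%g = lam x * lam y.
Hypothesis lam_neq0 : forall x, lam x != 0.
Hypothesis lam_inj : injective lam.
Hypothesis lam_fin : finite_set (range lam).

Lemma finite_of_range : finite_group G.
Proof.
rewrite /finite_group (_ : [set: G] = lam @^-1` (range lam)).
  by apply: finite_preimage lam_fin => x y _ _ /lam_inj.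
by apply/seteqP; split=> x // _; exists x.
Qed.

Lemma lam1 : lam 1%g = 1.
Proof. by apply: (mulfI (lam_neq0 1%g)); rewrite -lamM mulg1 mulr1. Qed.

Lemma lamX x n : lam (x ^+ n)%g = lam x ^+ n.
Proof. by elim: n => [|n IH]; rewrite ?expg0 ?lam1// expgS exprS lamM IH. Qed.

(** All [n] elements of the range are [n]-th roots of unity, as multiplication by one of
    them permutes them and so preserves their product; hence one of them is a primitive
    root. *)
Lemma cyclic_of_range : cyclic_group G.
Proof.
have /finite_seqP[s sE] := lam_fin; pose rs := undup s.
have rsP z : (z \in rs) = (z \in range lam).
  by rewrite mem_undup sE; apply/idP/idP => [/mem_set|/set_mem].
have lam_rs x : lam x \in rs by rewrite rsP; apply/mem_set; exists x.
have urs : uniq rs by exact: undup_uniq.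
have n0 : (0 < size rs)%N.
  by have := lam_rs 1%g; case: (rs).
have unity x : lam x ^+ size rs = 1.
  have uM : uniq [seq lam x * z | z <- rs].
    by rewrite map_inj_uniq// => y z; exact: mulfI.
  have sM : {subset [seq lam x * z | z <- rs] <= rs}.
    move=> _ /mapP[z + ->]; rewrite rsP => /set_mem[y _ <-].
    by rewrite -lamM.
  have [_ eM] := uniq_min_size uM sM (eq_leq (esym (size_map _ _))).
  have pM : perm_eq [seq lam x * z | z <- rs] rs by exact: uniq_perm.
  have : \prod_(z <- [seq lam x * z | z <- rs]) z = \prod_(z <- rs) z by exact: perm_big.
  rewrite big_map big_split /= big_const_seq count_predT iter_mulr_1.
  move=> /eqP; rewrite -{2}[\prod_(_ <- _) _]mul1r => /eqP; apply: mulIf.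
  rewrite prodf_seq_neq0; apply/allP => z; rewrite rsP => /set_mem[y _ <-].
  exact: lam_neq0.
have /hasP[zeta + prim] : has (size rs).-primitive_root rs.
  apply: has_prim_root => //; apply/allP => z; rewrite rsP => /set_mem[y _ <-].
  by rewrite unity_rootE unity.
rewrite rsP => /set_mem[g _ gz].
exists g => x; have [i xi] := prim_rootP prim (unity x).
by exists i; left; apply: lam_inj; rewrite lamX gz.
Qed.

End FiniteSubgroupsOfFields.

(** * Isotropy groups as groups of rotations *)

Section Isotropy.
Variable R : realType.
Local Notation C := (Cplx R).
Variables (D : set C) (psi : C -> C) (p : D).
Hypothesis cov : disk_covering D psi.
Hypothesis psi0 : psi 0 = set_val p.
Implicit Types f g : automorphism D.

(** Since [psi 0 = p], the rotation by [l] is the lift of [f] fixing the origin. *)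
Definition lifts_to_rotation f (l : C) := cmod l = 1 /\
  forall z, cmod z < 1 -> forall w : D, psi z = set_val w -> psi (l * z) = set_val (f w).

Lemma set_val_in (w : D) : D (set_val w).
Proof. exact: set_mem (valP w). Qed.

(** The self-map lives on the subtype [D], so it is extended to the plane before it is
    composed with [psi] and lifted. *)
Lemma self_map_lift (f : D -> D) : holomorphic_self_map f -> f p = p ->
  exists2 F : C -> C, F 0 = 0 & forall z, cmod z < 1 ->
    [/\ derivable F z 1, cmod (F z) < 1 &
        forall w : D, psi z = set_val w -> psi (F z) = set_val (f w)].
Proof.
move=> [F0 hF0 F0f] fp.
have DE z : D z -> exists w : D, set_val w = z.
  by move=> Dz; exists (exist _ z (mem_set Dz)).
pose h z := F0 (psi z).
have dh z : cmod z < 1 -> derivable h z 1.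
  move=> z1; apply: derivable_comp1; first exact: (dc_holo cov).
  by apply: hF0; exact: (dc_into cov).
have hD z : cmod z < 1 -> D (h z).
  move=> z1; have [w ww] := DE _ (dc_into cov z1).
  by rewrite /h -ww F0f; exact: set_val_in.
have o1 : cmod (0 : C) < 1 by rewrite cmod0.
have [|F F00 FP] := lift_exists cov (fun z z1 => derivable_continuous_at (dh z z1)) hD o1 o1.
  by rewrite /h psi0 F0f fp.
exists F => // z z1; have [p1 p2 p3] := FP _ z1; split; [|exact: p2|].
  apply: (lift_derivable cov z1 p1 p2 _ (dh _ z1)).
  have [e e0 H] : exists2 e : R, 0 < e & forall y, cmod (y - z) < e -> cmod y < 1.
    by apply/nbhsP; exact: near_disk.
  by apply/nbhsP; exists e => // y /H y1; have [] := FP _ y1.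
by move=> w zw; rewrite p3 /h zw F0f.
Qed.

(** The lifts [F] and [G] of [f] and of its inverse fix the origin, so they are inverse
    to each other by uniqueness of lifts.  The Schwarz lemma for both gives
    [|F z| = |z|]. *)
Lemma rotation_exists f : f p = p -> exists l, lifts_to_rotation f l.
Proof.
move=> fp.
have gp : aut_inv f p = p by rewrite -{1}fp aut_funK.
have [F F0 FP] := self_map_lift (aut_fun_holo f) fp.
have [G G0 GP] := self_map_lift (aut_inv_holo f) gp.
have DE z : cmod z < 1 -> exists w : D, psi z = set_val w.
  by move=> z1; exists (exist _ (psi z) (mem_set (dc_into cov z1))).
have inv (A B : C -> C) (u v : D -> D) : cancel u v ->
    A 0 = 0 -> B 0 = 0 ->
    (forall z, cmod z < 1 -> [/\ derivable A z 1, cmod (A z) < 1 &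
      forall w : D, psi z = set_val w -> psi (A z) = set_val (u w)]) ->
    (forall z, cmod z < 1 -> [/\ derivable B z 1, cmod (B z) < 1 &
      forall w : D, psi z = set_val w -> psi (B z) = set_val (v w)]) ->
    forall z, cmod z < 1 -> B (A z) = z.
  move=> uv A0 B0 AP BP z z1.
  apply: (lift_unique cov (F1 := fun z => B (A z)) (F2 := fun z => z) (p := 0)).
    by rewrite A0 B0.
  move=> t t01; have s1 : cmod (seg 0 z t) < 1.
    by apply: disk_convex => //; rewrite cmod0.
  have [a1 a2 a3] := AP _ s1; have [b1 b2 b3] := BP _ a2.
  have [w sw] := DE _ s1.
  split; [|exact: continuous_at_id|exact: b2|exact: s1|].
    exact: continuous_at_comp (derivable_continuous_at a1) (derivable_continuous_at b1).
  by rewrite (b3 _ (a3 _ sw)) uv sw.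
have GF := inv F G _ _ (aut_funK f) F0 G0 FP GP.
have sF z : cmod z < 1 -> cmod (F z) <= cmod z.
  by apply: schwarz F0 _ => // x x1; have [] := FP _ x1.
have sG z : cmod z < 1 -> cmod (G z) <= cmod z.
  by apply: schwarz G0 _ => // x x1; have [] := GP _ x1.
have isoF z : cmod z < 1 -> cmod (F z) = cmod z.
  move=> z1; apply/le_anti; rewrite sF//=.
  by have [_ Fz1 _] := FP _ z1; have := sG _ Fz1; rewrite GF.
have [l l1 Fl] := rotation (fun z z1 => let: And3 d _ _ := FP z z1 in d) isoF.
exists l; split=> // z z1 w zw; rewrite -Fl//.
by have [_ _] := FP _ z1; exact.
Qed.

Lemma rotation_unique f l l' : lifts_to_rotation f l -> lifts_to_rotation f l' -> l = l'.
Proof.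
move=> [l1 lP] [l'1 l'P].
have o1 : cmod (0 : C) < 1 by rewrite cmod0.
have [e e0 inj] := dc_inj cov o1.
pose t := Num.min e 1 / 2.
have m0 : 0 < Num.min e 1 by rewrite lt_min e0 ltr01.
have t0 : 0 < t by rewrite divr_gt0.
have m1 : Num.min e 1 <= e by rewrite ge_min lexx.
have m2 : Num.min e 1 <= 1 by rewrite ge_min lexx orbT.
have te : t < e by rewrite /t; lra.
have t1 : t < 1 by rewrite /t; lra.
have ct : cmod (toC t : C) = t by rewrite cmod_toC gtr0_norm.
have z1 : cmod (toC t : C) < 1 by rewrite ct.
pose w : D := exist _ (psi (toC t)) (mem_set (dc_into cov z1)).
have E : l * toC t = l' * toC t.
  apply: inj; rewrite ?subr0 ?cmodM ?l1 ?l'1 ?mul1r ?ct//.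
  by rewrite (lP _ z1 w erefl) (l'P _ z1 w erefl).
by apply: mulIf E; rewrite -cmod_eq0 ct gt_eqF.
Qed.

Lemma rotationM f g l l' : lifts_to_rotation f l -> lifts_to_rotation g l' ->
  lifts_to_rotation (f * g)%g (l * l').
Proof.
move=> [l1 lP] [l'1 l'P]; split; first by rewrite cmodM l1 l'1 mulr1.
move=> z z1 w zw; rewrite -mulrA; apply: lP; last exact: l'P.
by rewrite cmodM l'1 mul1r.
Qed.

Lemma rotation_inj f g l : lifts_to_rotation f l -> lifts_to_rotation g l -> f = g.
Proof.
move=> [_ fP] [_ gP]; apply/aut_eqP => w.
have [z z1 zw] := dc_onto cov (set_val_in w).
by apply: val_inj; rewrite /= -[LHS](fP _ z1 _ zw) -[RHS](gP _ z1 _ zw).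
Qed.

(** The circle is compact and is covered by disks on which [psi] is injective. *)
Lemma finite_fibre (r : R) (w : C) : r < 1 -> finite_set [set z : C | cmod z = r /\ psi z = w].
Proof.
move=> r1.
have /choice[e eP] : forall z, exists e : R, cmod z = r ->
    0 < e /\ forall x y, cmod x < 1 -> cmod y < 1 -> cmod (x - z) < e ->
       cmod (y - z) < e -> psi x = psi y -> x = y.
  move=> z; have [zr|zr] := pselect (cmod z = r); last by exists 0.
  have [|e e0 inj] := @dc_inj _ _ _ cov z; first by rewrite zr.
  by exists e.
pose B (z : C) : set C := [set x | cmod (x - z) < e z].
have := @compact_circle R 0 r; rewrite compact_cover => /(_ _ [set z : C | cmod z = r] B).
case.
- move=> z zr; rewrite openE => x xz; exact: near_ball.
- move=> z /=; rewrite subr0 => zr; exists z => //=; rewrite /B /= subrr cmod0.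
  by have [] := eP _ zr.
move=> I Ir; set J := (X in cover X B) => cov'.
have finJ : finite_set J by exact: finite_fset.
have sub : [set z : C | cmod z = r /\ psi z = w] `<=`
    \bigcup_(i in J) ([set z : C | cmod z = r /\ psi z = w] `&` B i).
  move=> z [zr zw]; have [|i iI Bi] := cov' z; first by rewrite /= subr0.
  by exists i.
apply: sub_finite_set sub _; apply: bigcup_finite; first exact: finJ.
move=> i iI; have ir : cmod i = r by have := Ir _ iI; rewrite inE.
have [e0 inj] := eP _ ir.
have [[x [[xr xw] xB]]|none] := pselect (exists x, ([set z | cmod z = r /\ psi z = w] `&` B i) x).
  apply: (sub_finite_set _ (@finite_set1 _ x)) => y [[yr yw] yB].
  by apply: inj => //; rewrite ?xr ?yr// xw yw.
by apply: (sub_finite_set _ (@finite_set0 _)) => y By; apply: none; exists y.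
Qed.

End Isotropy.

Theorem theorem35 (R : realType) (D : set (Cplx R)) (p : D) :
  hyperbolic_domain D -> ~ simply_connected D ->
  finite_group (isotropy_group p) /\ cyclic_group (isotropy_group p).
Proof.
move=> [_ [phi [_ /covering_charts cov0]]] nsc.
have [psi cov psi0] := disk_covering_at cov0 (set_val_in p).
have [a [a1 a_fib a0]] : exists a : Cplx R, [/\ cmod a < 1, psi a = psi 0 & a != 0].
  apply: contrapT => none; apply: nsc.
  apply: (injective_simply_connected cov); apply: (trivial_fibre_injective cov) => z z1 zf.
  by apply: contrapT => /eqP z0; apply: none; exists z.
have /choice[lam lamP] : forall x : isotropy_group p, exists l, lifts_to_rotation psi (\val x) l.
  by move=> x; apply: (rotation_exists cov psi0); exact/asboolP/(valP x).
have lamM x y : lam (x * y)%g = lam x * lam y.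
  apply: (rotation_unique cov (lamP (x * y)%g)).
  exact: rotationM (lamP x) (lamP y).
have lam_neq0 x : lam x != 0.
  by rewrite -cmod_eq0; have [-> _] := lamP x; rewrite oner_eq0.
have lam_inj : injective lam.
  move=> x y xy; apply: val_inj; apply: (rotation_inj cov (lamP x)); rewrite xy.
  exact: lamP.
have lam_fin : finite_set (range lam).
  rewrite (_ : range lam = (fun l => l * a) @^-1` ((fun l => l * a) @` range lam)); last first.
    apply/seteqP; split=> l; first by move=> ll; exists l.
    by move=> [m mm /(mulIf a0) <-].
  apply: finite_preimage; first by move=> l m _ _ /(mulIf a0).
  apply: (sub_finite_set _ (finite_fibre cov (set_val p) a1)).
  move=> _ [_ [x _ <-] <-]; have [l1 lP] := lamP x.
  split; first by rewrite cmodM l1 mul1r.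
  rewrite (lP _ a1 p) ?a_fib ?psi0//; congr set_val.
  exact/asboolP/(valP x).
split; first exact: finite_of_range lam_inj lam_fin.
exact: cyclic_of_range lamM lam_neq0 lam_inj lam_fin.
Qed.
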